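(* Let $\alpha>0$ and let $D\ge2$ be an integer. Let $(G,\rho)$ be a unimodular random rooted graph and $\xi$ a percolation of $(G,\rho)$ such that every vertex of $G_{D,\alpha}:=G[\xi]$ has degree at most $D$ and every infinite connected component of $G_{D,\alpha}$ has inner vertex-expansion constant at least $\alpha$. Then for every $\varepsilon\in(0,1/2)$ there is a positive integer $h$ (depending on $\varepsilon,\alpha,D$ but not on $N$) such that for every positive integer $N$ there exists a site percolation $\omega$ of $(G,\rho,\xi)$ of rate at most $\varepsilon$ such that almost surely: (I) every vertex of $G_{D,\alpha}[\omega]$ that lies in an infinite connected component of $G_{D,\alpha}$ is at distance at most $h$ in $G_{D,\alpha}$ from some vertex of $G_{D,\alpha}$ which is closed with respect to $\omega$; (II) for every vertex $v$ of $G_{D,\alpha}$ with $\omega(v)=0$, there is a set $\Psi\ni v$ of at least $N$ vertices of $G_{D,\alpha}$, all closed with respect to $\omega$, such that $G_{D,\alpha}[\Psi]$ is connected.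
   Context: A random rooted graph $(G,\rho)$ (root in a connected locally finite graph) is unimodular if for every Borel $f\ge0$ on doubly rooted (possibly marked) graphs, $\mathbb E[\sum_o f(G,\rho,o)]=\mathbb E[\sum_o f(G,o,\rho)]$. A marking is a random function from $V(G)\cup E(G)$ to a Polish space such that the marked rooted graph is unimodular; ''a site percolation of $(G,\rho,\xi)$'' means $(G,\rho,\xi,\omega)$ is unimodular. A percolation is a $\{0,1\}$-marking in which an edge is open (value 1) only if both endpoints are open; a site percolation additionally has every edge with both endpoints open being open. A vertex is closed if its value is 0. $G[\omega]$ denotes the subgraph of open vertices and edges, and $G_{D,\alpha}[\omega]$ the subgraph of $G_{D,\alpha}$ induced by vertices open for $\omega$. The rate of $\omega$ is $\mathbb P[\omega(\rho)=0]$. For finite $K\subseteq V$, $\partial_{\mathrm{in}}K$ is the set of vertices of $K$ adjacent to a vertex outside $K$; the inner vertex-expansion constant of a graph is $\inf\{|\partial_{\mathrm{in}}K|/|K|\}$ over finite nonempty vertex sets $K$. *)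

(* Defs.v *)
From mathcomp Require Import all_boot all_order all_algebra.
From mathcomp Require Import all_classical all_reals all_analysis.
From mathcomp Require Import measurable_realfun.
Import Order.TTheory GRing.Theory Num.Theory.
Set Implicit Arguments. Unset Strict Implicit. Unset Printing Implicit Defensive.
Local Open Scope classical_set_scope.
Local Open Scope ring_scope.

(* Labelled encoding of a graph with vertex set contained in nat, carrying  *)
(* k layers of {0,1}-marks on vertices and edges.                           *)
(* A configuration x : cfg k is a raw array x u v j (u v : nat, j < k+1):   *)
(*   layer 0 = the graph itself:  u is a vertex iff x u u 0,                *)
(*             u,v (u<>v, both vertices) adjacent iff x u v 0 && x v u 0;   *)
(*   layer i+1 (i < k) = the i-th {0,1}-marking: vertex mark x u u (i+1),   *)
(*             edge mark of {u,v} is x u v (i+1) && x v u (i+1).            *)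
(* Raw entries not described above are junk and are ignored by every       *)
(* notion below (in particular by the isomorphism-invariance condition).    *)
Definition cfg (k : nat) := nat -> nat -> 'I_k.+1 -> bool.

Definition vtx k (x : cfg k) (u : nat) : bool := x u u ord0.
Definition adj k (x : cfg k) (u v : nat) : bool :=
  [&& u != v, vtx x u, vtx x v, x u v ord0 & x v u ord0].
Definition vmark k (x : cfg k) (i : 'I_k) (u : nat) : bool := x u u (lift ord0 i).
Definition emark k (x : cfg k) (i : 'I_k) (u v : nat) : bool :=
  x u v (lift ord0 i) && x v u (lift ord0 i).

Definition cyl (k : nat) : set (set (cfg k)) :=
  [set A | exists u v i b, A = [set x : cfg k | x u v i = b]].
Definition cfgm (k : nat) := g_sigma_algebraType (@cyl k).
Definition T2 (k : nat) := (cfgm k * nat)%type.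
Definition T3 (k : nat) := (cfgm k * nat * nat)%type.

Definition reach (e : rel nat) (u v : nat) : Prop :=
  exists p : seq nat, path e u p /\ last u p = v.

Definition rooted_graph k (x : cfg k) (r : nat) : Prop :=
  [/\ vtx x r,
      (forall u v, vtx x u -> vtx x v -> reach (adj x) u v) &
      (forall u, vtx x u -> finite_set [set v | adj x u v])].

Definition iso k (x y : cfg k) (phi : nat -> nat) : Prop :=
  [/\ (forall u, vtx x u -> vtx y (phi u)),
      ((forall u v, vtx x u -> vtx x v -> phi u = phi v -> u = v) /\
       (forall w, vtx y w -> exists2 u, vtx x u & phi u = w)),
      (forall u v, vtx x u -> vtx x v -> adj y (phi u) (phi v) = adj x u v),
      (forall i u, vtx x u -> vmark y i (phi u) = vmark x i u) &
      (forall i u v, adj x u v -> emark y i (phi u) (phi v) = emark x i u v)].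

Definition iso_invariant k (R : realType) (f : T3 k -> \bar R) : Prop :=
  forall (x y : cfg k) (phi : nat -> nat) (a b : nat),
    iso x y phi -> vtx x a -> vtx x b ->
    f ((x : cfgm k), a, b) = f ((y : cfgm k), phi a, phi b).

Definition unimodular k (R : realType) (P : probability (T2 k) R) : Prop :=
  {ae P, forall z : T2 k, rooted_graph (z.1 : cfg k) z.2} /\
  forall f : T3 k -> \bar R,
    measurable_fun [set: T3 k] f -> (forall z, (0 <= f z)%E) -> iso_invariant f ->
    (\int[P]_z (\sum_(o <oo | vtx (z.1 : cfg k) o) f (z.1, z.2, o)))%E =
    (\int[P]_z (\sum_(o <oo | vtx (z.1 : cfg k) o) f (z.1, o, z.2)))%E.

Definition percolation k (x : cfg k) (i : 'I_k) : Prop :=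
  forall u v, adj x u v -> emark x i u v -> vmark x i u && vmark x i v.
Definition site_percolation k (x : cfg k) (i : 'I_k) : Prop :=
  forall u v, adj x u v -> emark x i u v = vmark x i u && vmark x i v.

Definition Hv k (x : cfg k) (i : 'I_k) (u : nat) : bool := vtx x u && vmark x i u.
Definition Hadj k (x : cfg k) (i : 'I_k) (u v : nat) : bool :=
  [&& adj x u v, emark x i u v, Hv x i u & Hv x i v].

Definition component (e : rel nat) (u : nat) : set nat := [set v | reach e u v].

Definition max_degree_le (hv : nat -> bool) (e : rel nat) (D : nat) : Prop :=
  forall u, hv u -> forall s : seq nat, uniq s -> (forall v, v \in s -> e u v) ->
    (size s <= D)%N.

(* inner vertex boundary of a finite set K (a seq without repetition) *)
Definition inner_boundary_size (e : rel nat) (K : seq nat) : nat :=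
  count (fun y => `[< exists z, e y z /\ z \notin K >]) K.

(* the subgraph induced on C (C is a connected component) has inner       *)
(* vertex-expansion constant >= alpha, i.e. inf |d_in K|/|K| >= alpha     *)
Definition expansion_ge (R : realType) (e : rel nat) (C : set nat) (alpha : R) : Prop :=
  forall K : seq nat, uniq K -> K != [::] -> (forall y, y \in K -> C y) ->
    alpha * (size K)%:R <= (inner_boundary_size e K)%:R.

Definition forget1 (x : cfg 2) : cfg 1 :=
  fun u v (j : 'I_2) => x u v (widen_ord (isT : (2 <= 3)%N) j).

Definition xi1 : 'I_1 := ord0.
Definition xi2 : 'I_2 := ord0.
Definition om2 : 'I_2 := ord_max.

(* Main.v *)
(* Let H = G_{D,alpha}. In the infinite components of H take two maximal     *)
(* separated sets: a net S of separation r, which will be h up to one, and a   *)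
(* much sparser net T, whose separation depends on N. Every vertex of S sends  *)
(* a path of length at most 2r + 1 to a vertex of T, or else to a vertex of S  *)
(* strictly closer to T; the closed set W is the union of these paths.         *)
(* - S is r-dense, which is (I).                                               *)
(* - Following the paths from S leads to T inside W, and every t in T is       *)
(*   reached in this way from all of S in a ball around t of radius much       *)
(*   larger than N, so the clusters of W have at least N vertices: this is     *)
(*   (II).                                                                     *)
(* - Every vertex of S pays for at most 2r + 2 vertices of W, and it owns a    *)
(*   ball of radius r/2, disjoint from the others and of cardinality at least  *)
(*   (1 + alpha)^(r/2) by expansion. By two mass transports the rate is at     *)
(*   most (2r + 2) / (1 + alpha)^(r/2), whatever N is.                         *)
(* The symmetry is broken by fair coins attached to the vertices: a vertex is  *)
(* coloured by a finite prefix of its coins that no other vertex in a large    *)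
(* ball has, and these colours drive the greedy choice of S and T and the      *)
(* choice of the paths. The law of the coins is invariant under injective      *)
(* relabellings, so averaging over them preserves unimodularity.               *)
From HB Require Import structures.
Require Import Defs.
From mathcomp Require Import all_boot all_order all_algebra.
From mathcomp Require Import all_classical all_reals all_analysis.
From mathcomp Require Import measurable_realfun zify ring lra.
Import Order.TTheory GRing.Theory Num.Theory.
Set Implicit Arguments. Unset Strict Implicit. Unset Printing Implicit Defensive.
Local Open Scope classical_set_scope.
Local Open Scope nat_scope.

(** * Distances and growth *)

(** Two scales keep [h] and the rate bound independent of [N]. Only S is charged: a ball of radius
    r/2 around a point of S is exponentially large in r ([ball_growth]), while the path chosen from
    that point has length linear in r. So some r depending on [eps] and [alpha] alone makes the rate
    at most [eps] ([closed_set_rate], [exp_beats_linear]). The separation of T may grow with [N] at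
    no cost, since points of T become closed only through paths already charged to S.

    A path towards T never gets stuck: r + 1 steps along a geodesic to T followed by at most r steps
    back to S still gain one unit ([admissible_ex]). Hence every closed cluster meets T, and the
    points of S well inside the ball around a point t of T all drain to t. One of them is at
    distance at least [N] from t, which makes the cluster large ([skeleton_large]); maximality of S
    gives density ([skeleton_dense]).

    These facts are deterministic once distinct vertices have distinct coin sequences, which holds
    almost surely ([ae_distinct_labels]). The construction commutes with isomorphisms of graphs with
    coins ([closed_set_iso]). Unimodularity is assumed for the graph without coins, so transports
    are integrated over the coins first; invariance of their law under injective relabelling
    ([fair_coins_reindex]) makes the averages isomorphism-invariant. The resulting [mass_transport]
    serves twice: for the rate, and for unimodularity of the marked law
    ([unimodular_marked_law]). *)

Definition dist_le (e : rel nat) (n u v : nat) : Prop :=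
  exists p, [/\ path e u p, last u p = v & size p <= n].

Lemma least (P : nat -> Prop) : (exists n, P n) ->
  exists2 n, P n & forall m, P m -> n <= m.
Proof.
move=> [n Pn]; have ex : exists n, `[< P n >] by exists n; apply/asboolP.
case: (ex_minnP ex) => m /asboolP Pm mmin; exists m => // k Pk.
by apply: mmin; apply/asboolP.
Qed.

Section Within.
Variable e : rel nat.
Local Notation dist_le := (dist_le e).

Lemma dist_le0 u : dist_le 0 u u. Proof. by exists [::]. Qed.

Lemma dist_le_mono n m u v : n <= m -> dist_le n u v -> dist_le m u v.
Proof. by move=> nm [p [? ? pn]]; exists p; split=> //; exact: leq_trans nm. Qed.

Lemma dist_le_refl n u : dist_le n u u.
Proof. exact: dist_le_mono (dist_le0 u). Qed.

Lemma dist_le0P u v : dist_le 0 u v -> u = v.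
Proof. by move=> [[|? ?] []]. Qed.

Lemma dist_le_path u p : path e u p -> dist_le (size p) u (last u p).
Proof. by exists p. Qed.

Lemma dist_le_trans n m u v w : dist_le n u v -> dist_le m v w -> dist_le (n + m) u w.
Proof.
move=> [p [ep <- pn]] [q [eq <- qm]]; exists (p ++ q).
by rewrite cat_path ep eq last_cat size_cat leq_add.
Qed.

Lemma dist_le_split n m u v : dist_le (n + m) u v ->
  exists w, dist_le n u w /\ dist_le m w v.
Proof.
move=> [p [ep <- pn]]; exists (last u (take n p)).
move: ep; rewrite -{1}(cat_take_drop n p) cat_path => /andP[e1 e2]; split.
  by exists (take n p); rewrite e1 size_take_min geq_minl.
exists (drop n p); rewrite e2 -last_cat cat_take_drop size_drop; split=> //.
by rewrite leq_subLR.
Qed.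

Lemma dist_leS n u v : dist_le n.+1 u v -> dist_le n u v \/
  exists w, dist_le n u w /\ e w v.
Proof.
rewrite -addn1 => /dist_le_split[w [uw [p [ep <- pn]]]].
case: p ep pn => [|a [|//]] /=; first by left.
by rewrite andbT => ea _; right; exists w.
Qed.

Lemma dist_le_edge n u v w : dist_le n u v -> e v w -> dist_le n.+1 u w.
Proof.
move=> uv vw; rewrite -addn1; apply: dist_le_trans uv _.
by exists [:: w]; rewrite /= vw.
Qed.

Lemma reach_dist_le u v : reach e u v <-> exists n, dist_le n u v.
Proof.
by split=> [[p [ep pv]]|[n [p [? ? _]]]]; [exists (size p); exists p | exists p].
Qed.

Lemma reach_trans u v w : reach e u v -> reach e v w -> reach e u w.
Proof.
move=> /reach_dist_le[n uv] /reach_dist_le[m vw].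
by apply/reach_dist_le; exists (n + m); exact: dist_le_trans vw.
Qed.

Lemma dist_le_reach n u v : dist_le n u v -> reach e u v.
Proof. by move=> uv; apply/reach_dist_le; exists n. Qed.

Hypothesis esym : symmetric e.

Lemma dist_le_sym n u v : dist_le n u v -> dist_le n v u.
Proof.
move=> [p [ep <- pn]]; exists (rev (belast u p)); split.
- by rewrite rev_path (eq_path (e' := e)) // => a b /=; rewrite esym.
- by case: p {ep pn} => //= a p; rewrite rev_cons last_rcons.
- by rewrite size_rev size_belast.
Qed.

Lemma reach_sym u v : reach e u v -> reach e v u.
Proof.
move=> /reach_dist_le[n uv].
by apply/reach_dist_le; exists n; exact: dist_le_sym.
Qed.

Hypothesis elf : forall u, finite_set [set v | e u v].

Lemma ball_finite n u : finite_set [set v | dist_le n u v].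
Proof.
elim: n => [|n IH].
  by apply: (@sub_finite_set _ _ [set u]) => // v /dist_le0P ->.
apply: (@sub_finite_set _ _
    ([set v | dist_le n u v] `|` \bigcup_(w in [set w | dist_le n u w]) [set v | e w v])).
  by move=> v /dist_leS[|[w [uw wv]]]; [left | right; exists w].
by rewrite finite_setU; split=> //; apply: bigcup_finite.
Qed.

Lemma finite_set_bounded (P : nat -> nat -> Prop) (A : set nat) :
    finite_set A -> (forall v, A v -> exists n, P v n) ->
    (forall v n m, n <= m -> P v n -> P v m) ->
  exists n, forall v, A v -> P v n.
Proof.
move=> /finite_seqP[s ->] + Pmono; elim: s => [|a s IH] Pex; first by exists 0.
have [|n Pn] := IH; first by move=> v vs; apply: Pex; rewrite /= inE vs orbT.
have [|m Pm] := Pex a; first by rewrite /= inE eqxx.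
exists (maxn n m) => v; rewrite /= inE => /predU1P[->|vs].
  by apply: Pmono Pm; exact: leq_maxr.
by apply: Pmono (Pn v vs); exact: leq_maxl.
Qed.

(** For finite degrees this says that the component of [u] is infinite ([unboundedP]). It is phrased
    with countable quantifiers only, which makes it a measurable condition. *)
Definition unbounded u := forall n, exists v, reach e u v /\ ~ dist_le n u v.

Lemma unboundedP u : unbounded u <-> ~ finite_set (component e u).
Proof.
split=> [ub fin|inf n].
  have [|n Pn] := @finite_set_bounded (fun v n => dist_le n u v) _ fin _
    (fun v n m => @dist_le_mono n m u v).
    by move=> v /reach_dist_le.
  by have [v [uv]] := ub n; apply; exact: Pn.
apply: contrapT => /forallNP nub; apply: inf.
apply: sub_finite_set (ball_finite n u) => v uv.
by apply: contrapT => nuv; apply: (nub v).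
Qed.

Lemma unbounded_reach u v : unbounded u -> reach e u v -> unbounded v.
Proof.
move=> ub /reach_dist_le[m uv] n; have [w [uw nw]] := ub (m + n).
exists w; split; first by apply: reach_trans uw; apply/reach_sym/dist_le_reach/uv.
by move=> vw; apply: nw; exact: dist_le_trans vw.
Qed.

(** A geodesic to a vertex at distance at least [n] is cut after [n] steps; the cut point cannot be
    closer, or the geodesic could be shortened. *)
Lemma unbounded_sphere u n : unbounded u ->
  exists v, dist_le n u v /\ forall m, dist_le m u v -> n <= m.
Proof.
move=> /(_ n)[v [/reach_dist_le/least[k uv kmin] nuv]].
have nk : n <= k by rewrite leqNgt; apply/negP => /ltnW kn; apply/nuv/dist_le_mono/uv.
move: uv; rewrite -(subnKC nk) => /dist_le_split[w [uw wv]].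
exists w; split=> // m mw; have := kmin _ (dist_le_trans mw wv); lia.
Qed.

Lemma ball_seq n u : exists s, uniq s /\ forall v, (v \in s) <-> dist_le n u v.
Proof.
have /finite_seqP[s sE] := ball_finite n u; exists (undup s).
rewrite undup_uniq; split=> // v; rewrite mem_undup.
by have := congr1 (@^~ v) sE => /= <-.
Qed.

End Within.

Section Growth.
Variables (R : realType) (e : rel nat) (alpha : R) (u : nat).
Hypothesis esym : symmetric e.
Hypothesis elf : forall v, finite_set [set w | e v w].
Hypothesis alpha0 : (0 <= alpha)%R.
Hypothesis expand : expansion_ge e (component e u) alpha.

Local Open Scope ring_scope.

(* The inner boundary of a ball lies in its outermost sphere. *)
Lemma ball_growth n s : uniq s -> (forall v, v \in s <-> dist_le e n u v) ->
  (1 + alpha) ^+ n <= (size s)%:R.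
Proof.
elim: n s => [|n IH] s us sE.
  rewrite expr0 ler1n lt0n size_eq0; apply/eqP => s0.
  by have := (sE u).2 (dist_le_refl e 0 u); rewrite s0.
have [t [ut tE]] := ball_seq elf n u.
have ts : {subset t <= s}.
  by move=> v /tE tv; apply/sE; exact: dist_le_mono tv.
have count_t : count (mem t) s = size t.
  rewrite -size_filter; apply/perm_size/uniq_perm; rewrite ?filter_uniq //.
  move=> v; rewrite mem_filter /=.
  by case: (boolP (v \in t)) => //= vt; exact: ts.
have bdry : (inner_boundary_size e s <= size s - size t)%N.
  rewrite -count_t -(count_predC (mem t) s) addKn.
  apply: sub_count => v /asboolP[w [vw ws]] /=; apply/negP => vt.
  by move/negP: ws; apply; apply/sE; apply: dist_le_edge vw; apply/tE.
have size_ts : (size t <= size s)%N by exact: uniq_leq_size.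
have nils : s != [::].
  apply/eqP => s0.
  by have := (sE u).2 (dist_le_refl e n.+1 u); rewrite s0.
have := expand us nils (fun v vs => dist_le_reach ((sE v).1 vs)).
move=> /le_trans/(_ (_ : _ <= (size s - size t)%:R)); rewrite ler_nat => /(_ bdry).
rewrite natrB // => st; have := IH t ut tE; rewrite exprS => tn.
have : (1 + alpha) * (1 + alpha) ^+ n <= (1 + alpha) * (size t)%:R.
  by rewrite ler_wpM2l // addr_ge0.
move=> /le_trans; apply.
have : alpha * (size t)%:R <= alpha * (size s)%:R by rewrite ler_wpM2l // ler_nat.
by rewrite mulrDl mul1r => *; lra.
Qed.

End Growth.

(** * Nets and the skeleton joining them *)

Section Nets.
Variables (e : rel nat) (Col : nat -> nat -> Prop).

(* Greedy in the colours: vertices of colour k enter at stage k + 1. *)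
Fixpoint net_upto (r k v : nat) : Prop :=
  if k is k'.+1 then
    net_upto r k' v \/
    [/\ unbounded e v, Col v k' & forall u, net_upto r k' u -> ~ dist_le e r u v]
  else False.

Definition net (r v : nat) : Prop := exists k, net_upto r k v.

Definition near_net (R n v : nat) : Prop := exists t, net R t /\ dist_le e n v t.

(* In the notation of the header, S is [net r] and T is [net R]. *)
Definition admissible (r R v : nat) (p : seq nat) : Prop :=
  [/\ path e v p, size p <= r.*2.+1 &
      net R (last v p) \/
      (net r (last v p) /\ exists n, near_net R n (last v p) /\ ~ near_net R n v)].

Fixpoint colours (p ks : seq nat) : Prop :=
  match p, ks with
  | [::], [::] => True
  | a :: p', k :: ks' => Col a k /\ colours p' ks'
  | _, _ => False
  end.

(** Ties are broken by the code of the colour sequence, not by the names of the vertices, so the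
    choice commutes with isomorphisms. *)
Definition chosen (r R v : nat) (p : seq nat) : Prop :=
  admissible r R v p /\
  exists ks, colours p ks /\
    forall q ls, admissible r R v q -> colours q ls -> pickle ks <= pickle ls.

Definition skeleton (r R u : nat) : Prop :=
  exists v p, [/\ net r v, chosen r R v p & u \in v :: p].

Hypothesis esym : symmetric e.
Hypothesis elf : forall u, finite_set [set v | e u v].
Hypothesis Col_ex : forall u, exists k, Col u k.

Lemma net_unbounded r v : net r v -> unbounded e v.
Proof. by move=> [k]; elim: k => [//|k IH] /= [/IH|[]]. Qed.

Lemma net_upto_mono r k l v : k <= l -> net_upto r k v -> net_upto r l v.
Proof. by move=> /subnKC <- nv; elim: (l - k) => [|m IH]; rewrite ?addn0 ?addnS //=; left. Qed.

(** At the stage of one of its colours, [v] is either blocked by a net vertex within [r] or enters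
    the net itself. *)
Lemma net_maximal r v : unbounded e v -> exists2 u, net r u & dist_le e r u v.
Proof.
move=> ub; have [k vk] := Col_ex v.
have [[u [nu uv]]|/forallNP nn] := pselect (exists u, net_upto r k u /\ dist_le e r u v).
  by exists u => //; exists k.
exists v; last exact: dist_le_refl.
by exists k.+1; right; split=> // u nu uv; apply: (nn u).
Qed.

Variable L : nat.
Hypothesis Col_inj : forall u v k, dist_le e L u v -> Col u k -> Col v k -> u = v.

(** The later of two net vertices was tested against the earlier one. If both enter at the same
    stage, they share a colour, and colours are injective within distance [L]. *)
Lemma net_separated r u v : r <= L -> net r u -> net r v -> dist_le e r u v -> u = v.
Proof.
move=> rL [k nu] [l nv] uv; have {}nu := net_upto_mono (leq_maxl k l) nu.
have {}nv := net_upto_mono (leq_maxr k l) nv; move: (maxn k l) nu nv => {k l}.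
elim=> [//|k IH] /= [nu|[_ ck nu]] [nv|[_ cl nv]].
- exact: IH.
- by case: (nv _ nu).
- by case: (nu _ nv); exact: dist_le_sym.
- exact: Col_inj (dist_le_mono rL uv) ck cl.
Qed.

Lemma colours_ex p : exists ks, colours p ks.
Proof.
elim: p => [|a p [ks pks]]; first by exists [::].
by have [k ak] := Col_ex a; exists (k :: ks).
Qed.

Lemma colours_inj p q ks : (forall a b, a \in p -> b \in q -> dist_le e L a b) ->
  colours p ks -> colours q ks -> p = q.
Proof.
elim: p q ks => [|a p IH] [|b q] [|k ks] //= pq [ak pks] [bk qks].
rewrite (IH q ks) // => [|x y xp yq]; last by apply: pq; rewrite inE ?xp ?yq orbT.
by rewrite (Col_inj _ ak bk) //; apply: pq; rewrite inE eqxx.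
Qed.

Lemma path_dist_le v p a : path e v p -> a \in v :: p -> dist_le e (size p) v a.
Proof.
move=> ep; rewrite inE => /predU1P[->|ap]; first exact: dist_le_refl.
case/splitPr: ap ep => p1 p2; rewrite cat_path /= => /and3P[e1 e2 _].
apply: (@dist_le_mono _ (size p1).+1); first by rewrite size_cat /=; lia.
by apply: dist_le_edge e2; exact: dist_le_path.
Qed.

(** Vertices of two admissible paths from [v] are at mutual distance at most 2(2r + 1), hence within
    [L], so equal colour sequences force equal paths. *)
Lemma chosen_unique r R v p q : r.*2.*2.+2 <= L ->
  chosen r R v p -> chosen r R v q -> p = q.
Proof.
move=> rL [ap [ks [cp pmin]]] [aq [ls [cq qmin]]].
have /(pcan_inj pickleK) ksE : pickle ks = pickle ls.
  by apply/eqP; rewrite eqn_leq (pmin q) // (qmin p).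
rewrite -ksE in cq; apply: (colours_inj _ cp cq) => a b ain bin.
case: ap aq => ep sp _ [eq sq _].
apply: (@dist_le_mono _ (size p + size q)); first by lia.
apply: (@dist_le_trans _ _ _ _ v).
  by apply: (dist_le_sym esym); apply: path_dist_le => //; rewrite inE ain orbT.
by apply: path_dist_le => //; rewrite inE bin orbT.
Qed.

(** If T is at distance d at most 2r + 1, a geodesic to T will do. Otherwise follow it for r + 1
    steps and then go to a point of S within r: the length is at most 2r + 1, and the new distance
    to T is at most d - (r + 1) + r = d - 1. *)
Lemma admissible_ex r R v : net r v -> exists p, admissible r R v p.
Proof.
move=> nv; have ub := net_unbounded nv.
have [t0 nt0 t0v] := net_maximal R ub.
have [|d [t [nt vt]] dmin] := @least (fun n => near_net R n v).
  by exists R, t0; split=> //; exact: (dist_le_sym esym).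
have [dr|rd] := leqP d r.*2.+1.
  case: vt => p [ep pt pd]; exists p; split=> //; first exact: leq_trans dr.
  by left; rewrite pt.
move: vt; rewrite -(@subnKC r.+1 d) ?(leq_trans _ rd) //; last by lia.
move=> /dist_le_split[y [vy yt]].
have [s ns sy] := net_maximal r (unbounded_reach esym ub (dist_le_reach vy)).
have [p [ep ps pn]] := dist_le_trans vy (dist_le_sym esym sy).
exists p; split=> //; first by lia.
right; rewrite ps; split=> //; exists (r + (d - r.+1)); split.
  by exists t; split=> //; exact: dist_le_trans yt.
by move=> /dmin; lia.
Qed.

Lemma chosen_ex r R v : net r v -> exists p, chosen r R v p.
Proof.
move=> nv; have [|k [p [ks [pa pc <-]]] kmin] := @least (fun k =>
   exists p ks, [/\ admissible r R v p, colours p ks & pickle ks = k]).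
  have [p pa] := admissible_ex R nv; have [ks pc] := colours_ex p.
  by exists (pickle ks), p, ks.
by exists p; split=> //; exists ks; split=> // q ls qa qc; apply: kmin; exists q, ls.
Qed.

Lemma skeleton_dense r R v : unbounded e v ->
  exists u p, [/\ skeleton r R u, path e v p, last v p = u & size p <= r].
Proof.
move=> ub; have [u nu /(dist_le_sym esym)[p [ep pu pr]]] := net_maximal r ub.
exists u, p; split=> //; have [q qc] := chosen_ex R nu.
by exists u, q; split=> //; rewrite inE eqxx.
Qed.

Lemma skeleton_unbounded r R v : skeleton r R v -> unbounded e v.
Proof.
move=> [u [p [nu [[ep _ _] _] vp]]].
by apply: (unbounded_reach esym (net_unbounded nu)); apply: dist_le_reach (path_dist_le ep vp).
Qed.

Definition closed_edge r R : rel nat := fun a b =>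
  [&& e a b, `[< skeleton r R a >] & `[< skeleton r R b >]].

Lemma closed_edge_sym r R : symmetric (closed_edge r R).
Proof. by move=> a b; rewrite /closed_edge esym [X in _ && X]andbC. Qed.

Lemma chosen_reach r R v p a : net r v -> chosen r R v p -> a \in v :: p ->
  reach (closed_edge r R) v a.
Proof.
move=> nv pc ap.
have pW : {in v :: p, forall b, skeleton r R b} by move=> b bp; exists v, p.
have ep : path (closed_edge r R) v p.
  case: pc => [[ep _ _] _]; elim: p v ep pW {nv ap} => //= b p IH v /andP[vb ep] pW.
  rewrite IH // => [|c cp]; last by apply: pW; rewrite inE cp orbT.
  rewrite andbT /closed_edge vb /=; apply/andP; split; apply/asboolP; apply: pW.
    by rewrite inE eqxx.
  by rewrite !inE eqxx orbT.
move: ap; rewrite inE => /predU1P[->|ap]; first by exists [::].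
case/splitPr: ap ep => p1 p2; rewrite -cat_rcons cat_path => /andP[e1 _].
by exists (rcons p1 a); rewrite last_rcons.
Qed.

Lemma near_mono R n m v : n <= m -> near_net R n v -> near_net R m v.
Proof. by move=> nm [t [nt vt]]; exists t; split=> //; exact: dist_le_mono vt. Qed.

(** Strong induction on the distance to T, which drops at each chosen path not ending in T. *)
Lemma net_reach_net r R v : net r v -> exists2 t, net R t & reach (closed_edge r R) v t.
Proof.
move=> nv; have [t0 nt0 t0v] := net_maximal R (net_unbounded nv).
have [n nearn] : exists n, near_net R n v.
  by exists R, t0; split=> //; exact: (dist_le_sym esym).
elim/ltn_ind: n v nv nearn {t0 nt0 t0v} => n IH v nv nearn.
have [p pc] := chosen_ex R nv.
have vw : reach (closed_edge r R) v (last v p) by apply: chosen_reach pc _; rewrite ?mem_last.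
case: (pc) => [[_ _ [nt|[nw [m [nearm nnear]]]]] _]; first by exists (last v p).
have mn : m < n by rewrite ltnNge; apply/negP => /near_mono/(_ nearn).
have [t nt wt] := IH m mn _ nw nearm.
by exists t => //; exact: reach_trans wt.
Qed.

(** The end of the chosen path is within n + 2r + 1 of [t]. If it lies in T, or is within n of some
    point of T, that point is within 2n + 2r + 1, hence within [R], of [t] and so equals [t]. The
    path thus ends at [t] or strictly closer to [t]. *)
Lemma net_reach_close r R n v t : R <= L -> n.*2 + r.*2.+1 <= R ->
  net r v -> net R t -> dist_le e n v t -> reach (closed_edge r R) v t.
Proof.
move=> RL nR nv nt; elim/ltn_ind: n v nv nR => n IH v nv nR vt.
have [p pc] := chosen_ex R nv.
have vw : reach (closed_edge r R) v (last v p) by apply: chosen_reach pc _; rewrite ?mem_last.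
case: (pc) => [[ep pr last_p] _].
have vwr : dist_le e r.*2.+1 v (last v p) by exists p.
have tw := dist_le_trans (dist_le_sym esym vt) vwr.
case: last_p => [nw|[nw [m [[t' [nt' wt']] nnear]]]].
  suff -> : t = last v p by [].
  by apply: (net_separated RL nt nw); apply: dist_le_mono tw; lia.
have mn : m < n.
  by rewrite ltnNge; apply/negP => nm; apply: nnear; exists t; split=> //; exact: dist_le_mono vt.
have t't : t = t'.
  apply: (net_separated RL nt nt'); apply: dist_le_mono (dist_le_trans tw wt'); lia.
rewrite -t't in wt'; apply: reach_trans vw _; apply: IH (mn) _ nw _ wt'; lia.
Qed.

(** The cluster of [u] contains some t in T. A point w of S within r of the sphere of radius N + r
    around t is at distance at least [N] and at most N + 2r from t, and drains to t; this needs 2(N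
    + 2r) + 2r + 1 at most [R]. A simple closed path from t to w then supplies the [N] vertices. *)
Lemma skeleton_large r R N u : R <= L -> N.*2 + (r * 6).+1 <= R -> skeleton r R u ->
  exists s, [/\ uniq s, size s = N & forall a, a \in s -> reach (closed_edge r R) u a].
Proof.
move=> RL NR [v [p [nv pc up]]].
have uv := reach_sym (@closed_edge_sym r R) (chosen_reach nv pc up).
have [t nt vt] := net_reach_net R nv.
have [y [ty ymin]] := unbounded_sphere (N + r) (net_unbounded nt).
have ub_y := unbounded_reach esym (net_unbounded nt) (dist_le_reach ty).
have [w nw wy] := net_maximal r ub_y.
have tw : forall m, dist_le e m t w -> N <= m.
  by move=> m tw; have := ymin _ (dist_le_trans tw wy); lia.
have wt : reach (closed_edge r R) w t.
  apply: (@net_reach_close r R (r + (N + r))) => //; first by lia.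
  exact: dist_le_trans wy (dist_le_sym esym ty).
have /(reach_sym (@closed_edge_sym r R))[q [eq qw]] := wt.
have ut := reach_trans uv vt.
move: qw; case/shortenP: eq => q' eq' uq' _ qw.
have q'e : path e t q' by apply: sub_path eq' => a b /and3P[].
exists (take N (t :: q')); split; first exact: take_uniq.
  have := tw _ (ex_intro _ q' (And3 q'e qw (leqnn _))).
  by rewrite size_take /=; case: ltngtP; lia.
move=> a /mem_take; rewrite inE => /predU1P[->//|aq'].
apply: reach_trans ut _.
case/splitPr: aq' eq' => p1 p2; rewrite -cat_rcons cat_path => /andP[e1 _].
by exists (rcons p1 a); rewrite last_rcons.
Qed.

End Nets.

(** * Equivariance *)

(** The maps are mutually inverse on the vertex sets only, their values elsewhere being arbitrary.
    Keeping [g] makes the record symmetric, so that each transport lemma also yields its converse,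
    including under the negations in the nets. *)
Record coloured_iso (V V' : pred nat) (e e' : rel nat) (Col Col' : nat -> nat -> Prop)
    (f g : nat -> nat) : Prop := ColouredIso {
  isoV : forall u, V u -> V' (f u);
  isoV' : forall u, V' u -> V (g u);
  isoK : forall u, V u -> g (f u) = u;
  isoK' : forall u, V' u -> f (g u) = u;
  iso_edge : forall u v, V u -> V v -> e' (f u) (f v) = e u v;
  edgeV : forall u v, e u v -> V u && V v;
  edgeV' : forall u v, e' u v -> V' u && V' v;
  iso_col : forall u k, V u -> Col u k -> Col' (f u) k;
  iso_col' : forall u k, V' u -> Col' u k -> Col (g u) k }.

Lemma coloured_iso_sym V V' e e' Col Col' f g :
  coloured_iso V V' e e' Col Col' f g -> coloured_iso V' V e' e Col' Col g f.
Proof.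
case=> fV gV fK gK fe eV eV' fC gC; split=> // u v Vu Vv.
by rewrite -fe ?gK //; exact: gV.
Qed.

Section PathInV.
Variables (V : pred nat) (e : rel nat).
Hypothesis edgeV : forall u v, e u v -> V u && V v.

Lemma path_all u p : path e u p -> all V p.
Proof. by elim: p u => //= a p IH u /andP[/edgeV/andP[_ ->] /IH]. Qed.

Lemma path_last u p : V u -> path e u p -> V (last u p).
Proof.
move=> Vu /path_all ap; have : last u p \in u :: p by exact: mem_last.
by rewrite inE => /predU1P[->//|]; exact: (allP ap).
Qed.

Lemma dist_le_V n u v : V v -> dist_le e n u v -> V u.
Proof. by move=> Vv [[|a p] [/=]]; [move=> _ -> | move=> /andP[/edgeV/andP[]]]. Qed.

Lemma reach_V u v : V u -> reach e u v -> V v.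
Proof. by move=> Vu [p [ep <-]]; exact: path_last ep. Qed.

Lemma unbounded_V u : unbounded e u -> V u.
Proof.
move=> /(_ 0)[v [[[|a p] [/= ep uv]] nuv]]; last by case/andP: ep => /edgeV/andP[].
by case: nuv; rewrite uv; exact: dist_le_refl.
Qed.

End PathInV.

Section Transport.
Variables (V V' : pred nat) (e e' : rel nat) (Col Col' : nat -> nat -> Prop) (f g : nat -> nat).
Hypothesis iso : coloured_iso V V' e e' Col Col' f g.

Lemma path_iso u p : V u -> path e u p -> path e' (f u) (map f p).
Proof.
elim: p u => //= a p IH u Vu /andP[ua ep].
have /andP[_ Va] := edgeV iso ua.
by rewrite (iso_edge iso) // ua; exact: IH.
Qed.

Lemma dist_le_iso n u v : V u -> dist_le e n u v -> dist_le e' n (f u) (f v).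
Proof.
move=> Vu [p [ep <- pn]]; exists (map f p).
by rewrite path_iso // last_map size_map.
Qed.

Lemma reach_iso u v : V u -> reach e u v -> reach e' (f u) (f v).
Proof. by move=> Vu [p [ep <-]]; exists (map f p); rewrite path_iso // last_map. Qed.

Lemma colours_iso p ks : all V p -> colours Col p ks -> colours Col' (map f p) ks.
Proof.
elim: p ks => [|a p IH] [|k ks] //= /andP[Va Vp] [ak pk].
by split; [exact: (iso_col iso) | exact: IH].
Qed.

End Transport.

Section Transport2.
Variables (V V' : pred nat) (e e' : rel nat) (Col Col' : nat -> nat -> Prop) (f g : nat -> nat).
Hypothesis iso : coloured_iso V V' e e' Col Col' f g.

Lemma dist_le_iso' n u v : V u -> V v -> dist_le e' n (f u) (f v) -> dist_le e n u v.
Proof.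
move=> Vu Vv /(dist_le_iso (coloured_iso_sym iso) (isoV iso Vu)).
by rewrite !(isoK iso).
Qed.

Lemma unbounded_iso u : unbounded e u -> unbounded e' (f u).
Proof.
move=> ub n; have Vu := unbounded_V (edgeV iso) ub.
have [v [uv nuv]] := ub n; exists (f v); split; first exact: (reach_iso iso).
by move=> /dist_le_iso'; move=> /(_ Vu (reach_V (edgeV iso) Vu uv)).
Qed.

End Transport2.

Lemma net_upto_iso r k V V' e e' Col Col' f g v :
  coloured_iso V V' e e' Col Col' f g ->
  net_upto e Col r k v -> net_upto e' Col' r k (f v).
Proof.
elim: k V V' e e' Col Col' f g v => //= k IH V V' e e' Col Col' f g v iso.
move=> [nv|[ub ck far]]; [left|right]; first exact: IH iso nv.
have Vv := unbounded_V (edgeV iso) ub.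
split; [exact: (unbounded_iso iso) | exact: (iso_col iso) |].
move=> u /(IH _ _ _ _ _ _ _ _ _ (coloured_iso_sym iso)) nu uv.
have Vu := dist_le_V (edgeV' iso) (isoV iso Vv) uv.
apply: (far _ nu); apply: (dist_le_iso' iso) => //; first exact: (isoV' iso).
by rewrite (isoK' iso).
Qed.

Lemma net_iso r V V' e e' Col Col' f g v :
  coloured_iso V V' e e' Col Col' f g -> net e Col r v -> net e' Col' r (f v).
Proof. by move=> iso [k nv]; exists k; exact: net_upto_iso iso nv. Qed.

Lemma near_iso R n V V' e e' Col Col' f g v :
  coloured_iso V V' e e' Col Col' f g -> V v -> near_net e Col R n v -> near_net e' Col' R n (f v).
Proof.
move=> iso Vv [t [nt vt]]; exists (f t).
by split; [exact: net_iso iso nt | exact: (dist_le_iso iso)].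
Qed.

Lemma admissible_iso r R V V' e e' Col Col' f g v p :
  coloured_iso V V' e e' Col Col' f g -> V v ->
  admissible e Col r R v p -> admissible e' Col' r R (f v) (map f p).
Proof.
move=> iso Vv [ep pr last_p]; split; [exact: (path_iso iso) | by rewrite size_map |].
have Vw := path_last (edgeV iso) Vv ep.
rewrite last_map; case: last_p => [nw|[nw [n [nearw nnear]]]]; [left|right].
  exact: net_iso iso nw.
split; [exact: net_iso iso nw | exists n; split; first exact: near_iso iso _ nearw].
by move=> /(near_iso (coloured_iso_sym iso) (isoV iso Vv)); rewrite (isoK iso).
Qed.

Lemma chosen_iso r R V V' e e' Col Col' f g v p :
  coloured_iso V V' e e' Col Col' f g -> V v ->
  chosen e Col r R v p -> chosen e' Col' r R (f v) (map f p).
Proof.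
move=> iso Vv [pa [ks [pks pmin]]]; split; first exact: admissible_iso iso _ pa.
exists ks; split.
  by apply: (colours_iso iso) pks; case: pa => /(path_all (edgeV iso)).
move=> q ls qa qls; apply: (pmin (map g q)).
  by rewrite -(isoK iso Vv); apply: admissible_iso (coloured_iso_sym iso) (isoV iso Vv) qa.
apply: (colours_iso (coloured_iso_sym iso)) qls.
by case: qa => /(path_all (edgeV' iso)).
Qed.

Lemma skeleton_iso r R V V' e e' Col Col' f g u :
  coloured_iso V V' e e' Col Col' f g ->
  skeleton e Col r R u -> skeleton e' Col' r R (f u).
Proof.
move=> iso [v [p [nv pc up]]]; exists (f v), (map f p).
have Vv := unbounded_V (edgeV iso) (net_unbounded nv).
split; [exact: net_iso iso nv | exact: chosen_iso iso _ pc |].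
by rewrite -map_cons map_f.
Qed.

(** A relation rather than a function: every prefix long enough to single out [v] in its ball of
    radius [L] codes a colour of [v]. *)
Definition bit_colour (e : rel nat) (L : nat) (U : nat -> nat -> bool) (v k : nat) : Prop :=
  exists s : seq bool, [/\ pickle s = k, mkseq (U v) (size s) = s &
    forall w, w <> v -> dist_le e L v w -> mkseq (U w) (size s) <> s].

Lemma bit_colour_inj e L U u v k :
  dist_le e L u v -> bit_colour e L U u k -> bit_colour e L U v k -> u = v.
Proof.
move=> uv [s [sk us sv]] [t [tk vt _]].
have st : s = t by apply: (pcan_inj pickleK); rewrite sk.
apply: contrapT => /nesym /sv/(_ uv); apply; rewrite st; exact: vt.
Qed.

(** The ball is finite, so one prefix length separates [v] from all its other members. *)
Lemma bit_colour_ex (e : rel nat) L (U : nat -> nat -> bool) v :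
  (forall u, finite_set [set w | e u w]) ->
  (forall w, w <> v -> exists j, U v j <> U w j) -> exists k, bit_colour e L U v k.
Proof.
move=> elf dist.
have [w wL|w n m nm Pn wv|n nP] := @finite_set_bounded
    (fun w n => w <> v -> exists2 j, j < n & U v j <> U w j) _ (ball_finite elf L v).
- have [->|/dist[j jP]] := pselect (w = v); first by exists 0.
  by exists j.+1 => _; exists j.
- by have [j jn ?] := Pn wv; exists j => //; exact: leq_trans nm.
exists (pickle (mkseq (U v) n)), (mkseq (U v) n).
rewrite size_mkseq; split=> // w wv /(nP w)/(_ wv)[j jn jP] E; apply: jP.
by rewrite -(nth_mkseq false (U v) jn) -E nth_mkseq.
Qed.

Lemma bit_colour_iso L V V' e e' Col Col' U U' f g v k :
  coloured_iso V V' e e' Col Col' f g -> (forall u, V u -> U' (f u) =1 U u) -> V v ->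
  bit_colour e L U v k -> bit_colour e' L U' (f v) k.
Proof.
move=> iso UU Vv [s [sk sv sw]]; exists s; split=> //; first by rewrite (eq_mkseq (UU v Vv)).
move=> w wv vw; have Vw : V' w.
  by apply: (reach_V (edgeV' iso)) (dist_le_reach vw); exact: (isoV iso).
have Vgw := isoV' iso Vw; rewrite -(isoK' iso Vw) (eq_mkseq (UU _ Vgw)).
apply: sw; first by move=> E; apply: wv; rewrite -E (isoK' iso).
apply: (dist_le_iso' iso) => //; by rewrite (isoK' iso).
Qed.

(** * Measurable predicates and fair coins *)

Section MeasurablePredicates.
Context d (T : measurableType d).

(** With this form, measurability is proved by following the syntax of a formula, its quantifiers
    ranging over countable types. *)
Definition mpred (P : T -> Prop) : Prop := measurable [set z | P z].

Lemma mpred_ext (P Q : T -> Prop) : (forall z, P z <-> Q z) -> mpred P -> mpred Q.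
Proof. by move=> PQ; rewrite /mpred (_ : mkset P = mkset Q) //; apply/seteqP; split=> z /PQ. Qed.

Lemma mpred_cst (P : Prop) : mpred (fun _ => P).
Proof.
have [p|np] := pselect P; [apply: (mpred_ext (P := setT)) | apply: (mpred_ext (P := set0))] => //.
- exact: measurableT.
- exact: measurable0.
Qed.

Lemma mpred_and (P Q : T -> Prop) : mpred P -> mpred Q -> mpred (fun z => P z /\ Q z).
Proof. exact: measurableI. Qed.

Lemma mpred_or (P Q : T -> Prop) : mpred P -> mpred Q -> mpred (fun z => P z \/ Q z).
Proof. exact: measurableU. Qed.

Lemma mpred_not (P : T -> Prop) : mpred P -> mpred (fun z => ~ P z).
Proof. exact: measurableC. Qed.

Lemma mpred_imply (P Q : T -> Prop) : mpred P -> mpred Q -> mpred (fun z => P z -> Q z).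
Proof.
move=> mP mQ; apply: mpred_ext (mpred_or (mpred_not mP) mQ) => z.
by split=> [[nP /nP|q _]|PQ] //; have [/PQ|] := pselect (P z); [right|left].
Qed.

Lemma mpred_ex (I : countType) (P : I -> T -> Prop) :
  (forall i, mpred (P i)) -> mpred (fun z => exists i, P i z).
Proof.
move=> mP; rewrite /mpred (_ : mkset _ = \bigcup_i [set z | P i z]).
  exact: countable_bigcupT_measurable.
by apply/seteqP; split=> z [i]; exists i.
Qed.

Lemma mpred_all (I : countType) (P : I -> T -> Prop) :
  (forall i, mpred (P i)) -> mpred (fun z => forall i, P i z).
Proof.
move=> mP; apply: mpred_ext (mpred_not (mpred_ex (fun i => mpred_not (mP i)))) => z.
split=> [/forallNP nP i|Pz [i]]; last exact.
by apply: contrapT; exact: nP.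
Qed.

End MeasurablePredicates.

Lemma mpred_comp d d' (T : measurableType d) (T' : measurableType d') (f : T -> T')
    (P : T' -> Prop) : measurable_fun [set: T] f -> mpred P -> mpred (fun z => P (f z)).
Proof. by move=> mf mP; rewrite /mpred -[mkset _]setTI; exact: mf. Qed.

Definition coordinate_cylinder : set (set (nat -> bool)) :=
  [set A | exists n b, A = [set B : nat -> bool | B n = b]].

Definition bits := g_sigma_algebraType coordinate_cylinder.

Lemma mpred_coord n b : mpred (fun B : bits => B n = b).
Proof. by apply: sub_sigma_algebra; exists n, b. Qed.

Lemma mpred_coord_eq m n : mpred (fun B : bits => B m = B n).
Proof.
apply: (mpred_ext (P := fun B : bits => exists c, B m = c /\ B n = c)).
  by move=> B; split=> [[c [-> ->]]//|e]; exists (B n).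
by apply: (mpred_ex (I := bool)) => c; apply: mpred_and; exact: mpred_coord.
Qed.

Lemma measurable_fun_bits d (T : measurableType d) (f : T -> bits) :
  (forall n, mpred (fun z => f z n)) -> measurable_fun [set: T] f.
Proof.
move=> mf; apply: (@measurability _ _ T bits setT f coordinate_cylinder) => //.
move=> _ [_ [n [b ->]] <-]; rewrite setTI.
suff : mpred (fun z => f z n = b) by [].
case: b; first exact: mf.
apply: mpred_ext (mpred_not (mf n)) => z.
by split=> [/negP|->] //; case: (f z n).
Qed.

Section FairCoins.
Variable R : realType.
Local Open Scope ring_scope.

(* Used on [0, 1] only; the absolute value keeps the argument of truncn nonnegative. *)
Definition digits (t : measurableTypeR R) : bits := fun n => odd (Num.truncn (`|t| * 2 ^+ n.+1)).

Lemma mpred_truncn n k : mpred (fun t : measurableTypeR R => Num.truncn (`|t| * 2 ^+ n) = k).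
Proof.
have m1 : measurable_fun setT (fun t : measurableTypeR R => `|t| * 2 ^+ n).
  by apply: measurable_funM => //; exact: measurable_normr.
apply: (mpred_ext (P := fun t : measurableTypeR R => `|t| * 2 ^+ n \in `[k%:R, k.+1%:R[)).
  move=> t; rewrite in_itv /= -truncn_eq ?mulr_ge0 ?exprn_ge0 //.
  by split=> /eqP.
apply: (mpred_comp m1 (P := fun y : measurableTypeR R => y \in `[k%:R, k.+1%:R[)).
exact: measurable_itv.
Qed.

Lemma measurable_digits : measurable_fun [set: measurableTypeR R] digits.
Proof.
apply: measurable_fun_bits => n.
apply: (mpred_ext (P := fun t : measurableTypeR R =>
  exists k, odd k /\ Num.truncn (`|t| * 2 ^+ n.+1) = k)).
  move=> t; rewrite /digits; split=> [[k [ok ->]] //|ok].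
  by exists (Num.truncn (`|t| * 2 ^+ n.+1)).
apply: (mpred_ex (I := nat)) => k; apply: mpred_and; first exact: mpred_cst.
exact: mpred_truncn.
Qed.

HB.instance Definition _ := isMeasurableFun.Build _ _ _ _ digits measurable_digits.

(** The binary digits of a uniform point of [0, 1] are independent fair bits; [fair_coins_prefix]
    confirms this on cylinders. *)
Definition fair_coins : probability bits R := distribution (uniform_prob (@ltr01 R)) digits.

Definition prefix_cylinder (n : nat) (w : nat -> bool) : set bits :=
  [set B | forall i, (i < n)%N -> B i = w i].

Lemma truncn_double_half (y : R) : 0 <= y -> (Num.truncn (y * 2))./2 = Num.truncn y.
Proof.
move=> y0; apply/esym/eqP; rewrite truncn_eq //.
have /andP[] := truncn_itv (mulr_ge0 y0 (ler0n R 2)); move: (Num.truncn _) => m my ym.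
have := odd_double_half m; move: (m./2) => k mE.
have : (k.*2 <= m < k.*2.+2)%N by case: (odd m) mE => /= <-; lia.
move=> /andP[]; rewrite -(ler_nat R) -(ler_nat R m.+1) -!addnn -!natr1 !natrD.
by move: my ym; rewrite -natr1 => *; apply/andP; split; lra.
Qed.

(** The integer with binary digits [w 0], ..., [w (n - 1)], most significant first. *)
Fixpoint prefix_value (w : nat -> bool) (n : nat) : nat :=
  if n is m.+1 then ((w m) + (prefix_value w m).*2)%N else 0%N.

Lemma digits_prefix (t : R) w n : 0 <= t < 1 ->
  prefix_cylinder n w (digits t) <-> Num.truncn (`|t| * 2 ^+ n) = prefix_value w n.
Proof.
move=> /andP[t0 t1]; have t2 m : 0 <= `|t| * 2 ^+ m by rewrite mulr_ge0 ?exprn_ge0.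
elim: n => [|n IH].
  rewrite expr0 mulr1 ger0_norm //=; split=> // _.
  by apply/eqP; rewrite truncn_eq // t0 t1.
have half : (Num.truncn (`|t| * 2 ^+ n.+1))./2 = Num.truncn (`|t| * 2 ^+ n).
  by rewrite exprSr mulrA truncn_double_half.
have dbl := odd_double_half (Num.truncn (`|t| * 2 ^+ n.+1)).
split=> [pre|/= tE].
  rewrite -dbl half /= (IH.1 _) => [|i ni]; last by apply: pre; exact: ltnW.
  by congr (_ + _)%N; rewrite -(pre n).
have [on vn] : w n = odd (Num.truncn (`|t| * 2 ^+ n.+1)) /\
    Num.truncn (`|t| * 2 ^+ n) = prefix_value w n.
  by rewrite -half tE half_bit_double oddD odd_double addbF oddb.
move=> i; rewrite ltnS leq_eqVlt => /predU1P[->//|]; exact: IH.2 vn i.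
Qed.

Lemma prefix_value_lt w n : (prefix_value w n < 2 ^ n)%N.
Proof. by elim: n => //= n IH; rewrite expnS; case: (w n) => /=; lia. Qed.

Lemma mpred_prefix n w : mpred (prefix_cylinder n w).
Proof.
by apply: mpred_all => i; apply: mpred_imply; [exact: mpred_cst | exact: mpred_coord].
Qed.

(** Fixing [n] digits confines the point to a dyadic interval of length 2^-n, up to the point 1,
    where the digit description fails and which is null. *)
Lemma fair_coins_prefix n w : fair_coins (prefix_cylinder n w) = ((2 ^+ n)^-1)%:E.
Proof.
set k := prefix_value w n; set c : R := (2 ^+ n)^-1.
have c0 : 0 < c by rewrite invr_gt0 exprn_gt0.
pose I : set (measurableTypeR R) := `[k%:R * c, k.+1%:R * c[%classic.
have IE t : 0 <= t -> I t <-> Num.truncn (`|t| * 2 ^+ n) = k.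
  move=> t0; rewrite /I /= in_itv /= ler_pdivrMr ?exprn_gt0 // ltr_pdivlMr ?exprn_gt0 //.
  rewrite ger0_norm // -truncn_eq ?mulr_ge0 ?exprn_ge0 //.
  by split=> /eqP.
have I01 t : I t -> 0 <= t < 1.
  rewrite /I /= in_itv /= => /andP[kt tk]; rewrite (le_trans _ kt) ?mulr_ge0 ?(ltW c0) //=.
  apply: (lt_le_trans tk); rewrite ler_pdivrMr ?exprn_gt0 // mul1r -natrX ler_nat.
  exact: prefix_value_lt.
have lI : lebesgue_measure I = c%:E.
  rewrite /I lebesgue_measure_itv /= lte_fin ltr_pM2r // ltr_nat ltnSn.
  by rewrite -EFinB -mulrBl -natr1 addrAC subrr add0r mul1r.
pose U := digits @^-1` prefix_cylinder n w.
have mU : measurable U by rewrite -[U]setTI; apply: measurable_digits => //; exact: mpred_prefix.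
have UE : fair_coins (prefix_cylinder n w) = lebesgue_measure (U `&` `[0, 1]%classic).
  transitivity (uniform_prob (@ltr01 R) U); first by [].
  rewrite /uniform_prob integral_uniform_pdf.
  rewrite -[RHS]mul1e -integral_cst //; last exact: measurableI.
  apply: eq_integral => t; rewrite inE /= in_itv /= => -[_ t01].
  by rewrite /uniform_pdf t01 subr0 invr1.
have IU : I `<=` U `&` `[0, 1]%classic.
  move=> t It; have t01 := I01 _ It; case/andP: (t01) => t0 t1.
  by split; [apply/(digits_prefix _ _ t01)/IE | rewrite /= in_itv /= t0 ltW].
have UI : U `&` `[0, 1]%classic `<=` I `|` [set 1].
  move=> t [Ut]; rewrite /= in_itv /= => /andP[t0 t1].
  have [->|t1'] := eqVneq t 1; [by right | left].
  by apply/IE => //; apply/digits_prefix => //; rewrite t0 lt_neqAle t1' t1.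
rewrite UE; apply/eqP; rewrite eq_le -lI; apply/andP; split.
  apply: (le_trans (le_measure _ _ _ UI)); rewrite ?inE; first exact: measurableI.
    by apply: measurableU => //; exact: measurable_itv.
  have mI : measurable I by exact: measurable_itv.
  have := @measureU2 _ _ _ (@lebesgue_measure R) I [set 1] mI (measurable_set1 _).
  by rewrite [X in (_ <= _ + X)%E]lebesgue_measure_set1 adde0.
by apply: le_measure; rewrite ?inE //; [exact: measurable_itv | exact: measurableI].
Qed.

(** Prefix cylinders and the empty set form a pi-system: two cylinders are either incompatible or
    meet in the longer prefix. They generate, since a condition on one coin is a countable union of
    them. *)
Lemma eq_measure_prefix (m1 m2 : {measure set bits -> \bar R}) : (m1 setT < +oo)%E ->
  (forall n w, m1 (prefix_cylinder n w) = m2 (prefix_cylinder n w)) ->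
  forall A, measurable A -> m1 A = m2 A.
Proof.
move=> m1oo m12.
pose G : set (set bits) := [set A | A = set0 \/ exists n w, A = prefix_cylinder n w].
have pT : prefix_cylinder 0 xpred0 = setT by apply/seteqP; split.
apply: (measure_unique G (fun=> setT)).
- apply/seteqP; split; apply: smallest_sub; try exact: smallest_sigma_algebra.
    move=> _ [n [b ->]]; pose GT := g_sigma_algebraType G.
    suff : mpred (fun B : GT => B n = b) by [].
    apply: (mpred_ext (P := fun B : GT => exists s : seq bool,
      prefix_cylinder n.+1 (fun i => if i == n then b else nth false s i) B)).
      move=> B; split=> [[s /(_ n (ltnSn n))]|Bn]; first by rewrite eqxx.
      exists (mkseq B n) => i; rewrite ltnS leq_eqVlt => /predU1P[->|iltn].
        by rewrite eqxx.
      by rewrite (ltn_eqF iltn) nth_mkseq.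
    apply: (mpred_ex (I := seq bool)) => s; apply: sub_sigma_algebra; right.
    by exists n.+1, (fun i => if i == n then b else nth false s i).
  move=> _ [->|[n [w ->]]]; [exact: measurable0 | exact: mpred_prefix].
- move=> A B [->|[n [w ->]]]; first by left; rewrite set0I.
  move=> [->|[m [v ->]]]; first by left; rewrite setI0.
  have [wv|/existsNP[i]] := pselect (forall i, (i < n)%N -> (i < m)%N -> w i = v i).
    right; exists (maxn n m), (fun i => if (i < n)%N then w i else v i).
    apply/seteqP; split=> [C [Cw Cv] i|C Cwv].
      by rewrite leq_max; case: ltnP => [/Cw//|_ /= /Cv].
    split=> i im; rewrite Cwv ?leq_max ?im ?orbT //; case: ifP => // ni; exact: wv.
  move=> /not_implyP[iltn /not_implyP[im wv]]; left.
  by apply/seteqP; split=> // C [/(_ i iltn) Ci /(_ i im)]; rewrite Ci.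
- by move=> _; right; exists 0%N, xpred0.
- by apply/seteqP; split=> // x _; exists 0%N.
- by move=> A [->|[n [w ->]]]; rewrite ?measure0.
- by [].
Qed.

Definition flip (i : nat) (B : bits) : bits := fun j => B j (+) (i == j).

Lemma flipE i (B : nat -> bool) j : flip i B j = B j (+) (i == j).
Proof. by []. Qed.

Lemma measurable_flip i : measurable_fun [set: bits] (flip i).
Proof.
apply: measurable_fun_bits => n; apply: (mpred_ext (P := fun B : bits => B n = (i != n))).
  by move=> B; rewrite /flip; case: (B n); case: (i == n).
exact: mpred_coord.
Qed.

HB.instance Definition _ i := isMeasurableFun.Build _ _ _ _ (flip i) (measurable_flip i).

Definition reindex (s : nat -> nat) (B : bits) : bits := B \o s.

Lemma measurable_reindex s : measurable_fun [set: bits] (reindex s).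
Proof. by apply: measurable_fun_bits => n; exact: (mpred_coord (s n) true). Qed.

HB.instance Definition _ s := isMeasurableFun.Build _ _ _ _ (reindex s) (measurable_reindex s).

Lemma fair_coins_flip i A : measurable A -> fair_coins (flip i @^-1` A) = fair_coins A.
Proof.
apply: (@eq_measure_prefix (distribution fair_coins (flip i)) fair_coins).
  by rewrite -[X in (X < _)%E]/(fair_coins setT) probability_setT ltry.
move=> n w; rewrite [RHS]fair_coins_prefix -(fair_coins_prefix n (flip i w)).
congr (fair_coins _); apply/seteqP; split=> B Bw j jn; have := Bw j jn;
by rewrite /= !flipE; case: (B j); case: (w j); case: (i == j).
Qed.

(** Flipping coin [i] preserves the law and exchanges the parts of [A] inside and outside [C]. This
    replaces independence in the two inductions below. *)
Lemma fair_coins_half i (A C : set bits) : measurable A -> measurable C ->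
  flip i @^-1` A = A -> flip i @^-1` C = ~` C ->
  (fair_coins A = 2%:E * fair_coins (A `&` C))%E.
Proof.
move=> mA mC fA fC; have mAC := measurableI _ _ mA mC.
have -> : fair_coins A = (fair_coins (A `&` C) + fair_coins (A `\` C))%E.
  rewrite -measureU //; [by rewrite setUIDK | exact: measurableD |].
  by apply/seteqP; split=> // x [[_ Cx] [_ /(_ Cx)]].
have -> : A `\` C = flip i @^-1` (A `&` C) by rewrite preimage_setI fA fC setDE.
by rewrite (fair_coins_flip i mAC) -mule2n mule_natl.
Qed.

(** By injectivity, coin [s n] is not read by the first [n] conditions, so each new condition halves
    the measure. *)
Lemma fair_coins_reindex_prefix s n w : injective s ->
  fair_coins (reindex s @^-1` prefix_cylinder n w) = ((2 ^+ n)^-1)%:E.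
Proof.
move=> sinj; elim: n => [|n IH].
  rewrite (_ : _ @^-1` _ = setT) ?probability_setT ?expr0 ?invr1 //.
  by apply/seteqP; split.
have mpre m v : measurable (reindex s @^-1` prefix_cylinder m v).
  by rewrite -[_ @^-1` _]setTI; apply: measurable_reindex => //; exact: mpred_prefix.
set C := [set B : bits | B (s n) = w n].
have preS : reindex s @^-1` prefix_cylinder n.+1 w =
    (reindex s @^-1` prefix_cylinder n w) `&` C.
  apply/seteqP; split=> B => [Bw|[Bw Bn] i].
    by split=> [i ltin|]; apply: Bw => //; exact: ltnW.
  by rewrite ltnS leq_eqVlt => /predU1P[->|/Bw].
have fA : flip (s n) @^-1` (reindex s @^-1` prefix_cylinder n w) =
    reindex s @^-1` prefix_cylinder n w.
  apply/seteqP; split=> B Bw i ltin; have := Bw i ltin;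
  by rewrite /reindex /= !flipE (inj_eq sinj) (gtn_eqF ltin) addbF.
have fC : flip (s n) @^-1` C = ~` C.
  by apply/seteqP; split=> B; rewrite /C /= flipE eqxx; case: (B _); case: (w n).
have half := fair_coins_half (mpre n w) (mpred_coord _ _) fA fC.
have -> : ((2 ^+ n.+1)^-1 : R)%:E = ((2^-1)%:E * ((2 ^+ n)^-1)%:E)%E.
  by rewrite exprS invfM EFinM.
by rewrite -IH half muleA -EFinM mulVf // mul1e preS.
Qed.

Lemma fair_coins_reindex s A : injective s -> measurable A ->
  fair_coins (reindex s @^-1` A) = fair_coins A.
Proof.
move=> sinj; apply: (@eq_measure_prefix (distribution fair_coins (reindex s)) fair_coins).
  by rewrite -[X in (X < _)%E]/(fair_coins setT) probability_setT ltry.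
by move=> n w; rewrite [RHS]fair_coins_prefix -(fair_coins_reindex_prefix n w sinj).
Qed.

(** Flipping coin [a n] spoils the n-th equality and no earlier one, so the first [n] equalities
    have probability 2^-n. *)
Lemma fair_coins_distinct (a b : nat -> nat) : injective a -> (forall i j, a i <> b j) ->
  fair_coins [set B : bits | forall k, B (a k) = B (b k)] = 0%E.
Proof.
move=> ainj ab; pose E n := [set B : bits | forall k, (k < n)%N -> B (a k) = B (b k)].
have mC k := mpred_coord_eq (a k) (b k).
have mE n : measurable (E n).
  apply: (mpred_all (P := fun k (B : bits) => (k < n)%N -> B (a k) = B (b k))) => k.
  by apply: mpred_imply => //; exact: mpred_cst.
have PE n : fair_coins (E n) = ((2 ^+ n)^-1)%:E.
  elim: n => [|n IH].
    rewrite (_ : E 0%N = setT) ?probability_setT ?expr0 ?invr1 //.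
    by apply/seteqP; split.
  pose C := [set B : bits | B (a n) = B (b n)].
  have ES : E n.+1 = E n `&` C.
    apply/seteqP; split=> B => [Bw|[Bw Bn] i].
      by split=> [i ltin|]; apply: Bw => //; exact: ltnW.
    by rewrite ltnS leq_eqVlt => /predU1P[->|/Bw].
  have fb k : (a n == b k) = false by apply/eqP; exact: ab.
  have fE : flip (a n) @^-1` E n = E n.
    apply/seteqP; split=> B Bw i ltin; have := Bw i ltin;
    by rewrite /= !flipE fb (inj_eq ainj) (gtn_eqF ltin) !addbF.
  have fC : flip (a n) @^-1` C = ~` C.
    by apply/seteqP; split=> B; rewrite /C /= !flipE fb eqxx; case: (B _); case: (B _).
  have half := fair_coins_half (mE n) (mC n) fE fC.
  have -> : ((2 ^+ n.+1)^-1 : R)%:E = ((2^-1)%:E * ((2 ^+ n)^-1)%:E)%E.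
    by rewrite exprS invfM EFinM.
  by rewrite -IH half muleA -EFinM mulVf // mul1e ES.
set A : set bits := [set _ | _].
have mA : measurable A by exact: (mpred_all (P := fun k (B : bits) => B (a k) = B (b k))).
apply/eqP; rewrite eq_le measure_ge0 andbT; apply/lee_addgt0Pr => e e0.
rewrite add0e; have [n en] : exists n, (2 ^+ n)^-1 <= e :> R.
  exists (Num.truncn e^-1); rewrite invf_ple ?posrE ?exprn_gt0 //.
  apply: le_trans (ltW (truncnS_gt _)) _; rewrite -natrX ler_nat; exact: ltn_expl.
apply: (@le_trans _ _ (fair_coins (E n))); last by rewrite PE lee_fin.
by apply: le_measure; rewrite ?inE // => B AB k _; exact: AB.
Qed.

End FairCoins.

(** * Measurability of the skeleton *)

Section MeasurableSkeleton.
Context d (T : measurableType d) (e : T -> rel nat) (Col : T -> nat -> nat -> Prop).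
Hypothesis me : forall u v, mpred (fun z => e z u v).

Lemma mpred_path u p : mpred (fun z => path (e z) u p).
Proof.
elim: p u => [|a p IH] u; first exact: (@mpred_cst _ _ true).
apply: mpred_ext (mpred_and (me u a) (IH a)) => z /=.
by split=> [[-> ->]|/andP].
Qed.

Lemma mpred_dist_le n u v : mpred (fun z => dist_le (e z) n u v).
Proof.
apply: (mpred_ext (P := fun z => exists p : seq nat,
  path (e z) u p /\ (last u p = v /\ size p <= n))).
  by move=> z; split=> [[p [? [? ?]]]|[p [? ? ?]]]; exists p.
apply: mpred_ex => p; apply: mpred_and; [exact: mpred_path | exact: mpred_cst].
Qed.

Lemma mpred_reach u v : mpred (fun z => reach (e z) u v).
Proof.
apply: mpred_ex => p; apply: mpred_and; [exact: mpred_path | exact: mpred_cst].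
Qed.

Lemma mpred_unbounded u : mpred (fun z => unbounded (e z) u).
Proof.
apply: mpred_all => n; apply: mpred_ex => v; apply: mpred_and; first exact: mpred_reach.
exact/mpred_not/mpred_dist_le.
Qed.

Lemma mpred_bit_colour L (U : T -> nat -> nat -> bool) v k :
  (forall u j b, mpred (fun z => U z u j = b)) ->
  mpred (fun z => bit_colour (e z) L (U z) v k).
Proof.
move=> mU.
have mprefix u (s : seq bool) : mpred (fun z => mkseq (U z u) (size s) = s).
  apply: (mpred_ext (P := fun z => forall i, i < size s -> U z u i = nth false s i)).
    move=> z; split=> [us|<- i]; last by rewrite size_mkseq => iu; rewrite nth_mkseq.
    apply: (@eq_from_nth _ false); first by rewrite size_mkseq.
    by move=> i; rewrite size_mkseq => iu; rewrite nth_mkseq // us.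
  by apply: mpred_all => i; apply: mpred_imply; [exact: mpred_cst | exact: mU].
apply: (mpred_ext (P := fun z => exists s : seq bool, pickle s = k /\
  (mkseq (U z v) (size s) = s /\
    forall w, w <> v -> (dist_le (e z) L v w -> mkseq (U z w) (size s) <> s)))).
  by move=> z; split=> [[s [? [? ?]]]|[s [? ? ?]]]; exists s.
apply: mpred_ex => s; apply: mpred_and; first exact: mpred_cst.
apply: mpred_and => //; apply: mpred_all => w; apply: mpred_imply; first exact: mpred_cst.
by apply: mpred_imply; [exact: mpred_dist_le | exact: mpred_not].
Qed.

Hypothesis mCol : forall u k, mpred (fun z => Col z u k).

Lemma mpred_net_upto r k v : mpred (fun z => net_upto (e z) (Col z) r k v).
Proof.
elim: k v => [|k IH] v; first exact: mpred_cst.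
apply: (mpred_ext (P := fun z => net_upto (e z) (Col z) r k v \/ (unbounded (e z) v /\
  (Col z v k /\ forall u, net_upto (e z) (Col z) r k u -> ~ dist_le (e z) r u v)))).
  by move=> z; split=> -[|[]]; [left | move=> ? [? ?]; right | left | right].
apply: mpred_or => //; apply: mpred_and; first exact: mpred_unbounded.
apply: mpred_and => //; apply: mpred_all => u; apply: mpred_imply => //.
exact/mpred_not/mpred_dist_le.
Qed.

Lemma mpred_net r v : mpred (fun z => net (e z) (Col z) r v).
Proof. by apply: mpred_ex => k; exact: mpred_net_upto. Qed.

Lemma mpred_near R n v : mpred (fun z => near_net (e z) (Col z) R n v).
Proof. by apply: mpred_ex => t; apply: mpred_and; [exact: mpred_net | exact: mpred_dist_le]. Qed.

Lemma mpred_admissible r R v p : mpred (fun z => admissible (e z) (Col z) r R v p).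
Proof.
apply: (mpred_ext (P := fun z => path (e z) v p /\ (size p <= r.*2.+1 /\
  (net (e z) (Col z) R (last v p) \/ (net (e z) (Col z) r (last v p) /\
   exists n, near_net (e z) (Col z) R n (last v p) /\ ~ near_net (e z) (Col z) R n v))))).
  by move=> z; split=> [[? []]|[]].
apply: mpred_and; first exact: mpred_path.
apply: mpred_and; first exact: mpred_cst.
apply: mpred_or; first exact: mpred_net.
apply: mpred_and; first exact: mpred_net.
by apply: mpred_ex => n; apply: mpred_and; [exact: mpred_near | exact/mpred_not/mpred_near].
Qed.

Lemma mpred_colours p ks : mpred (fun z => colours (Col z) p ks).
Proof.
by elim: p ks => [|a p IH] [|k ks] /=; try exact: mpred_cst; apply: mpred_and.
Qed.

Lemma mpred_chosen r R v p : mpred (fun z => chosen (e z) (Col z) r R v p).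
Proof.
apply: mpred_and; first exact: mpred_admissible.
apply: (mpred_ex (I := seq nat)) => ks; apply: mpred_and; first exact: mpred_colours.
apply: (mpred_all (I := seq nat)) => q; apply: (mpred_all (I := seq nat)) => ls.
apply: mpred_imply; first exact: mpred_admissible.
by apply: mpred_imply; [exact: mpred_colours | exact: mpred_cst].
Qed.

Lemma mpred_skeleton r R u : mpred (fun z => skeleton (e z) (Col z) r R u).
Proof.
apply: (mpred_ext (P := fun z => exists v, exists p : seq nat,
    net (e z) (Col z) r v /\ (chosen (e z) (Col z) r R v p /\ u \in v :: p))).
  by move=> z; split=> [[v [p [? [? ?]]]]|[v [p [? ? ?]]]]; exists v, p.
apply: mpred_ex => v; apply: mpred_ex => p; apply: mpred_and; first exact: mpred_net.
by apply: mpred_and; [exact: mpred_chosen | exact: mpred_cst].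
Qed.

End MeasurableSkeleton.

(** * Marked configurations *)

(* [ord_max] is the layer of the percolation omega. *)
Definition mark_with (x : cfg 1) (w : nat -> bool) : cfg 2 :=
  fun u v i => if unlift ord_max i is Some j then x u v j else w u && w v.

Definition label (B : bits) (v j : nat) : bool := B (pickle (v, j)).

Definition colouring (L : nat) (x : cfg 1) (B : bits) : nat -> nat -> Prop :=
  bit_colour (Hadj x xi1) L (label B).

(** The same [L] is the radius on which colours are injective and the separation of T. *)
Definition closed_set (r L : nat) (x : cfg 1) (B : bits) : nat -> Prop :=
  skeleton (Hadj x xi1) (colouring L x B) r L.

Lemma widen_lift (j : 'I_2) : widen_ord (isT : 2 <= 3) j = lift ord_max j.
Proof. by apply/val_inj; case: j => [[|[|]]]. Qed.

Lemma forget1_mark_with x w : forget1 (mark_with x w) = x.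
Proof.
apply/funext => u; apply/funext => v; apply/funext => j.
by rewrite /forget1 /mark_with widen_lift liftK.
Qed.

Lemma vmark_mark_with x w u : vmark (mark_with x w) om2 u = w u.
Proof.
rewrite /vmark /mark_with (_ : lift ord0 om2 = ord_max); last exact/val_inj.
by rewrite unlift_none andbb.
Qed.

Lemma emark_mark_with x w u v : emark (mark_with x w) om2 u v = w u && w v.
Proof.
rewrite /emark /mark_with (_ : lift ord0 om2 = ord_max); last exact/val_inj.
by rewrite unlift_none [X in _ && X]andbC andbb.
Qed.

Lemma vtx_forget1 (y : cfg 2) : vtx (forget1 y) = vtx y.
Proof. by apply/funext => u; rewrite /vtx /forget1; congr (y _ _ _); exact/val_inj. Qed.

Lemma adj_forget1 (y : cfg 2) : adj (forget1 y) = adj y.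
Proof.
apply/funext => u; apply/funext => v; rewrite /adj vtx_forget1 /forget1.
by rewrite (_ : widen_ord _ _ = ord0) //; exact/val_inj.
Qed.

Lemma lift_xi1 : widen_ord (isT : 2 <= 3) (lift ord0 xi1) = lift ord0 xi2.
Proof. exact/val_inj. Qed.

Lemma Hv_forget1 (y : cfg 2) : Hv (forget1 y) xi1 = Hv y xi2.
Proof.
by apply/funext => u; rewrite /Hv vtx_forget1 /vmark /forget1 lift_xi1.
Qed.

Lemma Hadj_forget1 (y : cfg 2) : Hadj (forget1 y) xi1 = Hadj y xi2.
Proof.
apply/funext => u; apply/funext => v.
by rewrite /Hadj adj_forget1 Hv_forget1 /emark /forget1 lift_xi1.
Qed.

Lemma rooted_graph_forget1 (y : cfg 2) r : rooted_graph (forget1 y) r -> rooted_graph y r.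
Proof. by rewrite /rooted_graph vtx_forget1 adj_forget1. Qed.

Lemma adj_sym k (x : cfg k) : symmetric (adj x).
Proof.
by move=> u v; rewrite /adj eq_sym [x u v _ && _]andbC !andbA [_ && vtx x v]andbAC.
Qed.

Lemma Hadj_sym k (x : cfg k) i : symmetric (Hadj x i).
Proof.
move=> u v; rewrite /Hadj adj_sym /emark [x u v _ && _]andbC.
by rewrite [Hv x i u && _]andbC.
Qed.

Lemma Hadj_locally_finite k (x : cfg k) i r :
  rooted_graph x r -> forall u, finite_set [set v | Hadj x i u v].
Proof.
move=> [_ _ lf] u; have [vu|nvu] := boolP (vtx x u).
  by apply: sub_finite_set (lf u vu) => v /and4P[].
apply: (@sub_finite_set _ _ set0) => // v /and4P[/and5P[_ vu _ _ _] _ _ _].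
by rewrite vu in nvu.
Qed.

Lemma Hadj_vtx k (x : cfg k) i u v : Hadj x i u v -> vtx x u && vtx x v.
Proof. by move=> /and4P[/and5P[_ -> -> _ _]]. Qed.

(** * Isomorphisms that also carry the coins *)

Section Isomorphism.
Variables (x y : cfg 1) (phi : nat -> nat) (B B' : bits) (L r : nat).
Hypothesis xy : iso x y phi.
Hypothesis BB' : forall u, vtx x u -> label B' (phi u) =1 label B u.

Lemma iso_inverse : exists g, forall w, vtx y w -> vtx x (g w) /\ phi (g w) = w.
Proof.
case: xy => _ [_ sur] _ _ _.
have sel w : exists u, vtx y w -> vtx x u /\ phi u = w.
  have [/sur[u xu uw]|nw] := boolP (vtx y w); [by exists u | by exists 0].
by have [g gP] := choice sel; exists g.
Qed.

Lemma colouring_iso : exists g, coloured_iso (vtx x) (vtx y) (Hadj x xi1) (Hadj y xi1)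
  (colouring L x B) (colouring L y B') phi g.
Proof.
have [g gP] := iso_inverse; exists g.
case: xy => fV [inj sur] fadj fvm fem.
(* Trivial colours first: transporting the actual colours already requires a [coloured_iso] of the
   underlying graphs. *)
have bare : coloured_iso (vtx x) (vtx y) (Hadj x xi1) (Hadj y xi1)
    (fun _ _ => True) (fun _ _ => True) phi g.
  split=> // [u /gP[]//|u xu|u /gP[]//|u v xu xv|u v|u v]; try exact: Hadj_vtx.
    by have [? ?] := gP _ (fV u xu); apply: inj.
  rewrite /Hadj /Hv fadj // !fvm // !fV // xu xv.
  by case: (boolP (adj x u v)) => //= uv; rewrite fem.
case: (bare) => *; split=> // u k xu; first exact: bit_colour_iso bare BB' xu.
apply: (bit_colour_iso (coloured_iso_sym bare)) => // v yv j.
by have [xg gv] := gP v yv; rewrite -BB' // gv.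
Qed.

Lemma net_colouring_iso v : vtx x v ->
  net (Hadj x xi1) (colouring L x B) r v <-> net (Hadj y xi1) (colouring L y B') r (phi v).
Proof.
move=> xv; have [g gi] := colouring_iso; split; first exact: net_iso gi.
by move=> /(net_iso (coloured_iso_sym gi)); rewrite (isoK gi).
Qed.

Lemma dist_le_Hadj_iso n u v : vtx x u -> vtx x v ->
  dist_le (Hadj x xi1) n u v <-> dist_le (Hadj y xi1) n (phi u) (phi v).
Proof.
move=> xu xv; have [g gi] := colouring_iso.
by split; [exact: (dist_le_iso gi) | exact: (dist_le_iso' gi)].
Qed.

Lemma closed_set_iso v : vtx x v -> closed_set r L x B v <-> closed_set r L y B' (phi v).
Proof.
move=> xv; have [g gi] := colouring_iso; split; first exact: skeleton_iso gi.
by move=> /(skeleton_iso (coloured_iso_sym gi)); rewrite (isoK gi).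
Qed.

Lemma mark_with_iso w w' : (forall u, vtx x u -> w' (phi u) = w u) ->
  iso (mark_with x w) (mark_with y w') phi.
Proof.
move=> ww'.
have vE a b : vtx (mark_with a b) = vtx a by rewrite -vtx_forget1 forget1_mark_with.
have aE a b : adj (mark_with a b) = adj a by rewrite -adj_forget1 forget1_mark_with.
have lE (i : 'I_2) : i = om2 \/ i = xi2.
  by case: i => [[|[|]]] // ilt; [right|left]; exact/val_inj.
have xE a b u v : mark_with a b u v (lift ord0 xi2) = a u v (lift ord0 xi1).
  by rewrite -[in RHS](forget1_mark_with a b) /forget1 lift_xi1.
case: xy => fV bij fadj fvm fem; split; rewrite ?vE ?aE // => i u.
  case: (lE i) => -> xu; first by rewrite !vmark_mark_with ww'.
  by rewrite /vmark !xE; exact: (fvm xi1).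
move=> v uv; have /and5P[_ xu xv _ _] := uv.
case: (lE i) => ->; first by rewrite !emark_mark_with !ww'.
by rewrite /emark !xE; exact: (fem xi1).
Qed.

End Isomorphism.

(** * Measurability of the marking *)

Lemma mpred_entry k u v (i : 'I_k.+1) b : mpred (fun x : cfgm k => (x : cfg k) u v i = b).
Proof. by apply: sub_sigma_algebra; exists u, v, i, b. Qed.

Lemma mpred_andb d (T : measurableType d) (P Q : T -> bool) :
  mpred P -> mpred Q -> mpred (fun z => P z && Q z).
Proof.
by move=> mP mQ; apply: mpred_ext (mpred_and mP mQ) => z; split=> /andP.
Qed.

Lemma mpred_adj k u v : mpred (fun x : cfgm k => adj x u v).
Proof.
by do ![apply: mpred_andb]; try exact: mpred_entry; exact: mpred_cst.
Qed.

Lemma mpred_Hv k (i : 'I_k) u : mpred (fun x : cfgm k => Hv x i u).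
Proof. by apply: mpred_andb; exact: mpred_entry. Qed.

Lemma mpred_Hadj k (i : 'I_k) u v : mpred (fun x : cfgm k => Hadj x i u v).
Proof.
apply: mpred_andb; first exact: mpred_adj.
by do ![apply: mpred_andb]; exact: mpred_entry.
Qed.

Lemma measurable_fun_cfgm d (T : measurableType d) k (f : T -> cfgm k) :
  (forall u v i b, mpred (fun z => (f z : cfg k) u v i = b)) -> measurable_fun [set: T] f.
Proof.
move=> mf; apply: (@measurability _ _ T (cfgm k) setT f (@cyl k)) => //.
by move=> _ [_ [u [v [i [b ->]]]] <-]; rewrite setTI; exact: mf.
Qed.

Lemma mpred_colouring L u k : mpred (fun z : cfgm 1 * bits => colouring L z.1 z.2 u k).
Proof.
apply: mpred_bit_colour => [a b|a j b].
  exact: (mpred_comp (P := fun x : cfgm 1 => Hadj x xi1 a b) measurable_fst (mpred_Hadj _ _ _)).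
exact: (mpred_comp measurable_snd (mpred_coord (pickle (a, j)) b)).
Qed.

Lemma mpred_Hadj_fst u v : mpred (fun z : cfgm 1 * bits => Hadj z.1 xi1 u v).
Proof.
exact: (mpred_comp (P := fun x : cfgm 1 => Hadj x xi1 u v) measurable_fst (mpred_Hadj _ _ _)).
Qed.

Lemma mpred_closed_set r L u : mpred (fun z : cfgm 1 * bits => closed_set r L z.1 z.2 u).
Proof.
apply: mpred_skeleton => [a b|a k]; [exact: mpred_Hadj_fst | exact: mpred_colouring].
Qed.

Definition open_marks (r L : nat) (x : cfg 1) (B : bits) (u : nat) : bool :=
  ~~ `[< closed_set r L x B u >].

Lemma measurable_mark_with r L : measurable_fun [set: cfgm 1 * bits]
  (fun z => mark_with z.1 (open_marks r L z.1 z.2) : cfgm 2).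
Proof.
apply: measurable_fun_cfgm => u v i b; rewrite /mark_with.
case: unliftP => [j _|_].
  exact: (mpred_comp measurable_fst (mpred_entry u v j b)).
have mo w : mpred (fun z : cfgm 1 * bits => open_marks r L z.1 z.2 w).
  apply: mpred_ext (mpred_not (mpred_closed_set r L w)) => z.
  by rewrite /open_marks; case: asboolP => c; split.
have mb : mpred (fun z : cfgm 1 * bits =>
    open_marks r L z.1 z.2 u && open_marks r L z.1 z.2 v) by exact: mpred_andb.
case: b; first exact: mb.
by apply: mpred_ext (mpred_not mb) => z /=; split=> [/negP/negbTE|->].
Qed.

(** * Averaging over the coins and mass transport *)

Section CountableComposition.
Context d d' (T : measurableType d) (T' : measurableType d').

Lemma measurable_fun_nat (h : T -> nat -> T') (n : T -> nat) :
  (forall k, measurable_fun [set: T] (h ^~ k)) -> measurable_fun [set: T] n ->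
  measurable_fun [set: T] (fun z => h z (n z)).
Proof.
move=> mh mn _ Y mY; rewrite setTI.
suff : mpred (fun z => Y (h z (n z))) by [].
apply: (mpred_ext (P := fun z => exists k, n z = k /\ Y (h z k))).
  by move=> z; split=> [[k [->]]|?] //; exists (n z).
apply: (mpred_ex (I := nat)) => k; apply: mpred_and.
  exact: (mpred_comp (P := fun m => m = k) mn).
exact: (mpred_comp (P := Y) (mh k)).
Qed.

Lemma measurable_fun_ifP (P : T -> bool) (f g : T -> T') : mpred P ->
  measurable_fun [set: T] f -> measurable_fun [set: T] g ->
  measurable_fun [set: T] (fun z => if P z then f z else g z).
Proof.
move=> mP mf mg _ Y mY; rewrite setTI.
suff : mpred (fun z => Y (if P z then f z else g z)) by [].
apply: (mpred_ext (P := fun z => (P z /\ Y (f z)) \/ (~ P z /\ Y (g z)))).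
  by move=> z; case: (P z); split=> [[[]|[]]|?] //; [left | right].
apply: mpred_or; apply: mpred_and => //; last 2 first.
- exact: mpred_not.
- exact: (mpred_comp (P := Y) mg).
- exact: (mpred_comp (P := Y) mf).
Qed.

End CountableComposition.

(** Lifts a relabelling of vertices to indices of coins. Indices coding no pair are fixed, which
    keeps the lift injective when [s] is. *)
Definition relabel (s : nat -> nat) (n : nat) : nat :=
  if @pickle_inv (nat * nat)%type n is Some p then pickle (s p.1, p.2) else n.

Lemma relabel_inj s : injective s -> injective (relabel s).
Proof.
move=> sinj m n; rewrite /relabel.
case mE: pickle_inv (@pickle_invK (nat * nat)%type m) => [p|] /= pm;
case nE: pickle_inv (@pickle_invK (nat * nat)%type n) => [q|] /= qn.
- move=> /(pcan_inj pickleK)[/sinj e1 e2]; rewrite -pm -qn.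
  by move: e1 e2; case: (p) (q) => [? ?] [? ?] /= -> ->.
- by move=> e; rewrite -e pickleK_inv in nE.
- by move=> e; rewrite e pickleK_inv in mE.
- by [].
Qed.

Lemma label_relabel s B v : label (reindex (relabel s) B) v = label B (s v).
Proof. by apply/funext => j; rewrite /label /reindex /= /relabel pickleK_inv. Qed.

Lemma measurable_drop_root :
  measurable_fun [set: T2 1 * bits] (fun z => (z.1.1, z.2) : cfgm 1 * bits).
Proof.
apply: measurable_fun_pair; last exact: measurable_snd.
exact: measurableT_comp measurable_fst measurable_fst.
Qed.

Section MassTransport.
Variable R : realType.
Local Open Scope ereal_scope.
Local Notation nu := (fair_coins R).

Lemma integral_reindex (h : bits -> \bar R) s : injective s ->
  measurable_fun [set: bits] h -> (forall B, 0 <= h B) ->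
  \int[nu]_B h (reindex s B) = \int[nu]_B h B.
Proof.
move=> sinj mh h0.
have := @ge0_integral_pushforward _ _ _ _ _ _ (measurable_reindex s) nu setT h measurableT mh
  (fun B _ => h0 B).
rewrite preimage_setT => <-.
apply: (@eq_measure_integral _ _ _ _ nu (distribution nu (reindex s))) => A mA _.
exact: fair_coins_reindex.
Qed.

Variable G : cfg 1 -> bits -> nat -> nat -> \bar R.
Hypothesis mG : forall a b, measurable_fun [set: cfgm 1 * bits] (fun z => G z.1 z.2 a b).
Hypothesis G0 : forall x B a b, 0 <= G x B a b.
Hypothesis G_iso : forall x y phi B B' a b, iso x y phi ->
  (forall u, vtx x u -> label B' (phi u) =1 label B u) -> vtx x a -> vtx x b ->
  G x B a b = G y B' (phi a) (phi b).

Definition averaged (t : T3 1) : \bar R := \int[nu]_B G t.1.1 B t.1.2 t.2.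

Lemma measurable_section x a b : measurable_fun [set: bits] (fun B => G x B a b).
Proof. exact: (measurableT_comp (mG a b) (pair1_measurable (x : cfgm 1))). Qed.

Lemma averaged_ge0 t : 0 <= averaged t.
Proof. by apply: integral_ge0 => B _; exact: G0. Qed.

Lemma measurable_averaged : measurable_fun [set: T3 1] averaged.
Proof.
apply: (@measurable_fun_nat _ _ (T3 1) (\bar R) (fun t b => \int[nu]_B G t.1.1 B t.1.2 b) snd);
  last exact: measurable_snd.
move=> b; apply: (@measurable_fun_nat _ _ (T3 1) (\bar R) (fun t a => \int[nu]_B G t.1.1 B a b)
  (fun t => t.1.2)); last exact: measurableT_comp measurable_snd measurable_fst.
move=> a; have mF := measurable_fun_fubini_tonelli_F (m2 := nu) _ (mG a b) (fun z => G0 _ _ _ _).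
exact: (measurableT_comp mF (measurableT_comp measurable_fst measurable_fst)).
Qed.

(* [phi] need not extend to an injection of nat. Both sides are compared through *)
(* coins relabelled to the even numbers on the vertices, the coins of the other  *)
(* labels of [x] being sent to the odd numbers.                                  *)
Lemma averaged_iso : iso_invariant averaged.
Proof.
move=> x y phi a b xy xa xb; rewrite /averaged /=.
pose s u := if vtx x u then (phi u).*2 else u.*2.+1.
have sinj : injective s.
  case: xy => _ [inj _] _ _ _ u v; rewrite /s.
  case: ifP => xu; case: ifP => xv; try by lia.
  by move=> /double_inj; exact: inj.
have dinj : injective (fun u => u.*2) by exact: double_inj.
rewrite -(integral_reindex (relabel_inj sinj)) //; last exact: measurable_section.
rewrite -[RHS](integral_reindex (relabel_inj dinj)) //; last exact: measurable_section.
apply: eq_integral => B _; apply: G_iso => // u xu j.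
by rewrite !label_relabel /s xu.
Qed.

Variable mu : probability (T2 1) R.
Hypothesis mu_unimodular : unimodular mu.

(** [H] arranges the root and the summation vertex in either order, so both sides of the mass
    transport are covered. *)
Lemma fubini_sum (H : T2 1 -> nat -> nat * nat) : 
  (forall o, measurable_fun [set: T2 1] (fun z => (H z o).1)) ->
  (forall o, measurable_fun [set: T2 1] (fun z => (H z o).2)) ->
  \int[mu \x nu]_z (\sum_(o <oo | vtx (z.1.1 : cfg 1) o) G z.1.1 z.2 (H z.1 o).1 (H z.1 o).2) =
  \int[mu]_z (\sum_(o <oo | vtx (z.1 : cfg 1) o) averaged (z.1, (H z o).1, (H z o).2)).
Proof.
move=> mH1 mH2.
have sum0 (z : T2 1 * bits) : 0 <= \sum_(o <oo | vtx (z.1.1 : cfg 1) o)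
    G z.1.1 z.2 (H z.1 o).1 (H z.1 o).2.
  by apply: nneseries_ge0 => *; exact: G0.
have mGH o : measurable_fun [set: T2 1 * bits] (fun z => G z.1.1 z.2 (H z.1 o).1 (H z.1 o).2).
  apply: (@measurable_fun_nat _ _ (T2 1 * bits)%type (\bar R) (fun z b => G z.1.1 z.2 (H z.1 o).1 b)
    (fun z => (H z.1 o).2)); last exact: measurableT_comp (mH2 o) measurable_fst.
  move=> b; apply: (@measurable_fun_nat _ _ (T2 1 * bits)%type (\bar R) (fun z a => G z.1.1 z.2 a b)
    (fun z => (H z.1 o).1)); last exact: measurableT_comp (mH1 o) measurable_fst.
  move=> a; exact: (measurableT_comp (mG a b) measurable_drop_root).
rewrite fubini_tonelli1 //; last first.
  have -> : (fun z : T2 1 * bits => \sum_(o <oo | vtx (z.1.1 : cfg 1) o)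
      G z.1.1 z.2 (H z.1 o).1 (H z.1 o).2) =
    (fun z => \sum_(o <oo) if vtx (z.1.1 : cfg 1) o then
      G z.1.1 z.2 (H z.1 o).1 (H z.1 o).2 else 0).
    by apply/funext => z; exact: eseries_mkcond.
  apply: ge0_emeasurable_sum => [k z _ _|k _]; first by case: ifP.
  apply: measurable_fun_ifP => //.
  exact: (mpred_comp (P := fun x : cfgm 1 => vtx x k)
    (measurableT_comp measurable_fst measurable_fst) (mpred_entry _ _ _ _)).
apply: eq_integral => z _; rewrite /fubini_F /=.
under eq_integral => B _ do rewrite (eseries_mkcond (fun o => G z.1 B (H z o).1 (H z o).2)).
rewrite integral_nneseries //.
- rewrite (eseries_mkcond (fun o => averaged (z.1, (H z o).1, (H z o).2))).
  apply: eq_eseriesr => o _.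
  by case: (vtx _ o) => //; rewrite integral0_eq.
- by move=> o; case: (vtx _ o); [exact: measurable_section | exact: measurable_cst].
- by move=> o B _; case: ifP.
Qed.

(* Averaging over the coins turns an equivariant function of the coins into  *)
(* an isomorphism-invariant one, so that unimodularity of mu applies.        *)
Lemma mass_transport :
  \int[mu \x nu]_z (\sum_(o <oo | vtx (z.1.1 : cfg 1) o) G z.1.1 z.2 z.1.2 o) =
  \int[mu \x nu]_z (\sum_(o <oo | vtx (z.1.1 : cfg 1) o) G z.1.1 z.2 o z.1.2).
Proof.
have out := @fubini_sum (fun z o => (z.2, o)) (fun=> measurable_snd) (fun=> measurable_cst _).
have inc := @fubini_sum (fun z o => (o, z.2)) (fun=> measurable_cst _) (fun=> measurable_snd).
apply: etrans out (etrans _ (esym inc)).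
exact: (mu_unimodular.2 _ measurable_averaged averaged_ge0 averaged_iso).
Qed.

End MassTransport.

(** * The rate *)

Section AlmostEverywhere.
Context d1 d2 (T1 : measurableType d1) (T2 : measurableType d2) (R : realType).
Variables (P1 : probability T1 R) (P2 : probability T2 R).
Local Open Scope ereal_scope.

Lemma ae_fst (P : T1 -> Prop) : {ae P1, forall x, P x} ->
  {ae P1 \x P2, forall z, P z.1}.
Proof.
move=> [A [mA A0 PA]]; exists (A `*` setT); split; first exact: measurableX.
  have -> : (P1 \x P2) (A `*` setT) = P1 A * P2 setT by exact: product_measure1E.
  by rewrite (A0 : P1 A = 0) mul0e.
by move=> z nPz; split => //; exact: PA.
Qed.

Lemma ae_snd (P : T2 -> Prop) : {ae P2, forall x, P x} ->
  {ae P1 \x P2, forall z, P z.2}.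
Proof.
move=> [A [mA A0 PA]]; exists (setT `*` A); split; first exact: measurableX.
  have -> : (P1 \x P2) (setT `*` A) = P1 setT * P2 A by exact: product_measure1E.
  by rewrite (A0 : P2 A = 0) mule0.
by move=> z nPz; split => //; exact: PA.
Qed.

End AlmostEverywhere.

Section CountingSums.
Variable R : realType.
Local Open Scope ereal_scope.

Definition ind (P : Prop) : \bar R := (`[< P >]%:R)%:E.

Lemma ind_ge0 P : 0 <= ind P.
Proof. by rewrite lee_fin ler0n. Qed.

Lemma sum_ind (F : nat -> Prop) n :
  \sum_(0 <= i < n) ind (F i) = ((count (fun i => `[< F i >]) (iota 0 n))%:R)%:E.
Proof.
elim: n => [|n IH]; first by rewrite big_geq.
rewrite big_nat_recr // -addn1 iotaD count_cat natrD EFinD -IH.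
by congr (_ + _); rewrite /= add0n addn0.
Qed.

Lemma nneseries_ind_ge (F : nat -> Prop) s : uniq s -> (forall i, i \in s -> F i) ->
  ((size s)%:R)%:E <= \sum_(i <oo) ind (F i).
Proof.
move=> us sF; pose n := (\max_(i <- s) i).+1.
apply: (@le_trans _ _ (\sum_(0 <= i < n) ind (F i))); last first.
  by apply: nneseries_lim_ge => i _ _; exact: ind_ge0.
rewrite sum_ind lee_fin ler_nat -size_filter; apply: uniq_leq_size => // i is_.
rewrite mem_filter mem_iota /= add0n ltnS; apply/andP; split.
  by apply/asboolP; exact: sF.
exact: (@leq_bigmax_seq _ s xpredT id).
Qed.

Lemma nneseries_ind_le (F : nat -> Prop) (d : nat) :
  (forall s, uniq s -> (forall i, i \in s -> F i) -> (size s <= d)%N) ->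
  \sum_(i <oo) ind (F i) <= (d%:R)%:E.
Proof.
move=> Fd; apply: lime_le; first by apply: is_cvg_nneseries => i _ _; exact: ind_ge0.
apply: nearW => n; rewrite sum_ind lee_fin ler_nat -size_filter; apply: Fd.
  by apply: filter_uniq; exact: iota_uniq.
by move=> i; rewrite mem_filter => /andP[/asboolP].
Qed.

Context d (T : measurableType d) (P : probability T R).

Lemma measurable_ind (A : T -> Prop) : mpred A -> measurable_fun [set: T] (fun z => ind (A z)).
Proof.
move=> mA; have -> : (fun z => ind (A z)) = (fun z => if `[< A z >] then 1 else 0).
  by apply/funext => z; rewrite /ind; case: `[< _ >].
apply: measurable_fun_ifP => //; first by apply: mpred_ext mA => z; split=> /asboolP.
Qed.

Lemma measurable_nneseries_ind (F : T -> nat -> Prop) : (forall i, mpred (F ^~ i)) ->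
  measurable_fun [set: T] (fun z => \sum_(i <oo) ind (F z i)).
Proof.
move=> mF; apply: ge0_emeasurable_sum => [i z _ _|i _]; first exact: ind_ge0.
exact: measurable_ind.
Qed.

Lemma integral_ind (A : T -> Prop) : mpred A -> \int[P]_z ind (A z) = P [set z | A z].
Proof.
move=> mA; have <- : \int[P]_z (\1_[set z | A z] z)%:E = P [set z | A z].
  by rewrite integral_indic // setIT.
by apply: eq_integral => z _; rewrite /ind indicE.
Qed.

Lemma integral_counting_ge (F : T -> nat -> Prop) (A : T -> Prop) (c : R) :
  (forall i, mpred (F ^~ i)) -> mpred A -> (0 <= c)%R ->
  {ae P, forall z, A z ->
    exists s, [/\ uniq s, forall i, i \in s -> F z i & (c <= (size s)%:R)%R]} ->
  c%:E * P [set z | A z] <= \int[P]_z \sum_(i <oo) ind (F z i).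
Proof.
move=> mF mA c0 AF; rewrite -integral_ind // -ge0_integralZl_EFin //; first last.
- exact: measurable_ind.
- by move=> *; exact: ind_ge0.
apply: ae_ge0_le_integral => //.
- by move=> *; rewrite mule_ge0 ?lee_fin ?ler0n.
- by apply: measurable_funeM; exact: measurable_ind.
- by move=> *; apply: nneseries_ge0 => *; exact: ind_ge0.
- exact: measurable_nneseries_ind.
apply: filterS AF => z AF _; rewrite {1}/ind; case: asboolP => [Az|_]; last first.
  by rewrite mule0; apply: nneseries_ge0 => *; exact: ind_ge0.
have [s [us sF cs]] := AF Az; rewrite mule1.
by apply: le_trans (nneseries_ind_ge us sF); rewrite lee_fin.
Qed.

Lemma integral_counting_le (F : T -> nat -> Prop) (A : T -> Prop) (k : nat) :
  (forall i, mpred (F ^~ i)) -> mpred A ->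
  {ae P, forall z, (forall i, F z i -> A z) /\
    forall s, uniq s -> (forall i, i \in s -> F z i) -> (size s <= k)%N} ->
  \int[P]_z \sum_(i <oo) ind (F z i) <= (k%:R)%:E * P [set z | A z].
Proof.
move=> mF mA FA; rewrite -integral_ind // -ge0_integralZl_EFin //; first last.
- exact: measurable_ind.
- by move=> *; exact: ind_ge0.
apply: ae_ge0_le_integral => //.
- by move=> *; apply: nneseries_ge0 => *; exact: ind_ge0.
- exact: measurable_nneseries_ind.
- by move=> *; rewrite mule_ge0 ?lee_fin ?ler0n.
- by apply: measurable_funeM; exact: measurable_ind.
apply: filterS FA => z [FA Fk] _; rewrite {2}/ind; case: asboolP => [Az|nAz].
  by rewrite mule1; exact: nneseries_ind_le.
rewrite mule0 eseries0 // => i _ _; rewrite /ind; case: asboolP => // /FA Az.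
by case: nAz.
Qed.

End CountingSums.

Lemma ae_distinct_labels (R : realType) : {ae fair_coins R, forall B : bits,
  forall v w, w <> v -> exists j, label B v j <> label B w j}.
Proof.
apply/ae_foralln => v; apply/ae_foralln => w.
have [->|wv] := pselect (w = v); first exact/nearW.
have pinj := pcan_inj (@pickleK (nat * nat)%type).
have ainj : injective (fun k : nat => pickle (v, k)) by move=> i j /pinj[].
have ab (i j : nat) : pickle (v, i) <> pickle (w, j) :> nat.
  by move=> E; case: (pinj _ _ E) => vw _; apply: wv.
exists [set B : bits | forall k : nat, B (pickle (v, k)) = B (pickle (w, k))]; split.
- apply: (mpred_all (P := fun (k : nat) (B : bits) => B (pickle (v, k)) = B (pickle (w, k)))) => k.
  exact: mpred_coord_eq.
- exact: fair_coins_distinct.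
move=> B /not_implyP[_ /forallNP eqvw] k; apply: contrapT; exact: eqvw.
Qed.

Lemma mpred_root (A : cfg 1 -> bits -> nat -> Prop) :
  (forall a, mpred (fun z : cfgm 1 * bits => A z.1 z.2 a)) ->
  mpred (fun z : T2 1 * bits => A z.1.1 z.2 z.1.2).
Proof.
move=> mA; apply: (mpred_ext (P := fun z : T2 1 * bits => exists a, z.1.2 = a /\ A z.1.1 z.2 a)).
  by move=> z; split=> [[a [->]]|?] //; exists z.1.2.
apply: (mpred_ex (I := nat)) => a; apply: mpred_and.
  exact: (mpred_comp (P := fun m => m = a) (measurableT_comp measurable_snd measurable_fst)).
exact: (mpred_comp measurable_drop_root (mA a)).
Qed.

Section Rate.
Variables (R : realType) (mu : probability (T2 1) R).
Hypothesis mu_unimodular : unimodular mu.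
Local Open Scope ereal_scope.
Local Notation nu := (fair_coins R).

Lemma counting_transport (K : cfg 1 -> bits -> nat -> nat -> Prop) :
  (forall a b, mpred (fun z : cfgm 1 * bits => K z.1 z.2 a b)) ->
  (forall x B a b, K x B a b -> vtx x a && vtx x b) ->
  (forall x y phi B B' a b, iso x y phi ->
    (forall u, vtx x u -> label B' (phi u) =1 label B u) -> vtx x a -> vtx x b ->
    K x B a b <-> K y B' (phi a) (phi b)) ->
  \int[mu \x nu]_z (\sum_(o <oo) ind R (K z.1.1 z.2 z.1.2 o)) =
  \int[mu \x nu]_z (\sum_(o <oo) ind R (K z.1.1 z.2 o z.1.2)).
Proof.
move=> mK Kv Kiso; pose G x B a b := ind R (K x B a b).
have := @mass_transport _ G _ (fun _ _ _ _ => ind_ge0 _ _) _ _ mu_unimodular.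
have vtx_sum (z : T2 1 * bits) (F : nat -> Prop) : (forall o, F o -> vtx (z.1.1 : cfg 1) o) ->
    \sum_(o <oo | vtx (z.1.1 : cfg 1) o) ind R (F o) = \sum_(o <oo) ind R (F o).
  move=> Fv; rewrite (eseries_mkcond (fun o => ind R (F o))); apply: eq_eseriesr => o _.
  by case: ifP => // /negP nv; rewrite /ind; case: asboolP => // /Fv.
under eq_integral => z _.
  by rewrite vtx_sum; [over | move=> o /Kv/andP[]].
move=> ->; first last.
- move=> x y phi B B' a b xy BB' xa xb; rewrite /G.
  by congr (ind R _); apply/propext; exact: Kiso.
- by move=> a b; exact: measurable_ind.
by apply: eq_integral => z _; rewrite vtx_sum // => o /Kv/andP[].
Qed.

(** The almost sure properties from which density, large clusters and ball growth follow
    deterministically. *)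
Definition good (alpha : R) (x : cfg 1) (B : bits) : Prop :=
  [/\ forall u, finite_set [set v | Hadj x xi1 u v],
      forall u, unbounded (Hadj x xi1) u ->
        expansion_ge (Hadj x xi1) (component (Hadj x xi1) u) alpha &
      forall v w, w <> v -> exists j, label B v j <> label B w j].

Variables (alpha : R) (n L : nat).
Hypothesis alpha0 : (0 <= alpha)%R.
Local Notation r := n.*2.
Hypothesis rL : (r.*2.*2.+2 <= L)%N.
Hypothesis ae_good : {ae mu \x nu, forall z, good alpha z.1.1 z.2}.

Definition pays (x : cfg 1) (B : bits) (a b : nat) : Prop :=
  net (Hadj x xi1) (colouring L x B) r a /\
  exists p : seq nat, chosen (Hadj x xi1) (colouring L x B) r L a p /\ b \in a :: p.

Definition owns (x : cfg 1) (B : bits) (a b : nat) : Prop :=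
  net (Hadj x xi1) (colouring L x B) r a /\ dist_le (Hadj x xi1) n a b.

Lemma net_vtx x B a : net (Hadj x xi1) (colouring L x B) r a -> vtx x a.
Proof. by move=> /net_unbounded; apply: unbounded_V; exact: Hadj_vtx. Qed.

Lemma pays_iso x y phi B B' a b : iso x y phi ->
  (forall u, vtx x u -> label B' (phi u) =1 label B u) -> vtx x a -> vtx x b ->
  pays x B a b <-> pays y B' (phi a) (phi b).
Proof.
move=> xy BB' xa xb; rewrite /pays (net_colouring_iso L r xy BB') //.
have [g gi] := colouring_iso L xy BB'.
split=> -[na [p [pa bp]]]; split=> //.
  exists (map phi p); split; first exact: chosen_iso gi xa pa.
  by rewrite -map_cons map_f.
exists (map g p); split.
  rewrite -(isoK gi xa).
  exact: chosen_iso (coloured_iso_sym gi) (isoV gi xa) pa.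
by rewrite -(isoK gi xa) -(isoK gi xb) -map_cons map_f.
Qed.

Lemma owns_iso x y phi B B' a b : iso x y phi ->
  (forall u, vtx x u -> label B' (phi u) =1 label B u) -> vtx x a -> vtx x b ->
  owns x B a b <-> owns y B' (phi a) (phi b).
Proof.
move=> xy BB' xa xb; rewrite /owns (net_colouring_iso L r xy BB') //.
by rewrite (dist_le_Hadj_iso L xy BB').
Qed.

Lemma mpred_net_root : mpred (fun z : T2 1 * bits =>
  net (Hadj (z.1.1 : cfg 1) xi1) (colouring L z.1.1 z.2) r z.1.2).
Proof.
apply: (mpred_root (A := fun x B a => net (Hadj x xi1) (colouring L x B) r a)) => a.
by apply: mpred_net => [u v|u k]; [exact: mpred_Hadj_fst | exact: mpred_colouring].
Qed.

Lemma mpred_pays a b : mpred (fun z : cfgm 1 * bits => pays z.1 z.2 a b).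
Proof.
have mH := mpred_Hadj_fst; have mC := mpred_colouring L.
apply: mpred_and; first exact: mpred_net.
apply: (mpred_ex (I := seq nat)) => p; apply: mpred_and; first exact: mpred_chosen.
exact: mpred_cst.
Qed.

Lemma mpred_owns a b : mpred (fun z : cfgm 1 * bits => owns z.1 z.2 a b).
Proof.
have mH := mpred_Hadj_fst; have mC := mpred_colouring L.
by apply: mpred_and; [exact: mpred_net | exact: mpred_dist_le].
Qed.

Lemma colouring_inj x B u v k : dist_le (Hadj x xi1) L u v ->
  colouring L x B u k -> colouring L x B v k -> u = v.
Proof. exact: bit_colour_inj. Qed.

Lemma colouring_ex x B u : good alpha x B -> exists k, colouring L x B u k.
Proof. by move=> [lf _ dist]; apply: bit_colour_ex lf (dist u). Qed.

(* Every closed vertex is paid for by a net vertex, which pays for at most *)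
(* [2r + 2] vertices; the balls of radius [n = r / 2] owned by the net     *)
(* vertices are disjoint and large.                                        *)
Lemma closed_set_rate :
  ((1 + alpha) ^+ n)%:E * (mu \x nu) [set z | closed_set r L z.1.1 z.2 z.1.2] <=
  (r.*2.+2)%:R%:E.
Proof.
pose netset := [set z : T2 1 * bits |
  net (Hadj (z.1.1 : cfg 1) xi1) (colouring L z.1.1 z.2) r z.1.2].
have mclosed : mpred (fun z : T2 1 * bits => closed_set r L z.1.1 z.2 z.1.2).
  by apply: mpred_root => a; exact: mpred_closed_set.
have a0 : (0 <= (1 + alpha) ^+ n)%R by rewrite exprn_ge0 // addr_ge0.
(* A closed root is paid for by at least one vertex, whereas a root pays for at most 2r + 2
   vertices, and for none unless it lies in S: its chosen path is unique and has length at most 2r +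
   1. *)
have paid : (mu \x nu) [set z | closed_set r L z.1.1 z.2 z.1.2] <=
    (r.*2.+2)%:R%:E * (mu \x nu) netset.
  rewrite -[leLHS]mul1e.
  apply: le_trans (@integral_counting_ge _ _ _ (mu \x nu) (fun z o => pays z.1.1 z.2 o z.1.2)
    (fun z => closed_set r L z.1.1 z.2 z.1.2) 1%R _ mclosed ler01 _) _.
  - by move=> o; apply: (mpred_root (A := fun x B a => pays x B o a)) => a; exact: mpred_pays.
  - apply: nearW => z [v [p [nv pc zp]]]; exists [:: v]; split=> // o.
    by rewrite inE => /eqP ->; split=> //; exists p.
  rewrite -(counting_transport mpred_pays) => [|x B a b|]; first last.
  - exact: pays_iso.
  - move=> [na [p [[[ep _ _] _] bp]]]; have xa := net_vtx na; rewrite xa /=.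
    exact: (reach_V (@Hadj_vtx _ x xi1) xa (dist_le_reach (path_dist_le ep bp))).
  apply: integral_counting_le; last 1 first.
  - apply: nearW => z; split=> [i [] //|s us sK].
    case: s us sK => [//|o s] us sK; have [nz [p [pc op]]] := sK o (mem_head _ _).
    have sp : {subset o :: s <= z.1.2 :: p}.
      move=> v vs; have [_ [q [qc vq]]] := sK v vs.
      by rewrite (chosen_unique (@Hadj_sym _ _ _) (@colouring_inj _ _) rL pc qc).
    apply: leq_trans (uniq_leq_size us sp) _; rewrite /= ltnS.
    by case: pc => [[_ pr _] _].
  - by move=> o; apply: (mpred_root (A := fun x B a => pays x B a o)) => a; exact: mpred_pays.
  - exact: mpred_net_root.
(* A root in S owns its whole ball of radius n. No vertex is owned twice, as two owners would be
   within 2n = r of each other. *)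
have owned : ((1 + alpha) ^+ n)%:E * (mu \x nu) netset <= 1.
  apply: le_trans (@integral_counting_ge _ _ _ (mu \x nu) (fun z o => owns z.1.1 z.2 z.1.2 o)
    (fun z => netset z) _ _ mpred_net_root a0 _) _.
  - by move=> o; apply: (mpred_root (A := fun x B a => owns x B a o)) => a; exact: mpred_owns.
  - have F : Filter (almost_everywhere (mu \x nu)) by exact: ae_filter_ringOfSetsType.
    apply: (@filterS _ _ F) ae_good => z [lf exp _] nz.
    have [s [us sE]] := ball_seq lf n z.1.2; exists s; split=> //.
      by move=> o /sE zo; split.
    by apply: (ball_growth lf alpha0 (exp _ (net_unbounded nz)) us).
  rewrite (counting_transport mpred_owns) => [|x B a b|]; first last.
  - exact: owns_iso.
  - move=> [na ab]; have xa := net_vtx na; rewrite xa /=.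
    exact: (reach_V (@Hadj_vtx _ x xi1) xa (dist_le_reach ab)).
  apply: le_trans (@integral_counting_le _ _ _ (mu \x nu) _ (fun=> True) 1 _ _ _) _.
  - by move=> o; apply: (mpred_root (A := fun x B a => owns x B o a)) => a; exact: mpred_owns.
  - exact: mpred_cst.
  - apply: nearW => z; split=> // s us sK.
    case: s us sK => [//|a [//|b s]] us sK.
    have [na az] := sK a (mem_head _ _).
    have [nb bz] : owns z.1.1 z.2 b z.1.2 by apply: sK; rewrite !inE eqxx orbT.
    suff ab : a = b by move: us; rewrite ab /= inE eqxx.
    apply: (net_separated (@Hadj_sym _ _ _) (@colouring_inj _ _) _ na nb); first by lia.
    rewrite -addnn; apply: dist_le_trans az _; apply: dist_le_sym bz; exact: Hadj_sym.
  by rewrite mul1e; apply: probability_le1; exact: measurableT.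
apply: (@le_trans _ _ (((1 + alpha) ^+ n)%:E * ((r.*2.+2)%:R%:E * (mu \x nu) netset))).
  by apply: lee_wpmul2l => //; rewrite lee_fin.
by rewrite muleCA -[leRHS]mule1; apply: lee_wpmul2l => //; rewrite lee_fin ler0n.
Qed.

End Rate.

(** * The marked law *)

Definition add_marks (r L : nat) (z : T2 1 * bits) : T2 2 :=
  ((mark_with z.1.1 (open_marks r L z.1.1 z.2) : cfgm 2), z.1.2).

Lemma measurable_add_marks r L : measurable_fun [set: T2 1 * bits] (add_marks r L).
Proof.
apply: measurable_fun_pair; last exact: measurableT_comp measurable_snd measurable_fst.
exact: (measurableT_comp (measurable_mark_with r L) measurable_drop_root).
Qed.

HB.instance Definition _ r L :=
  isMeasurableFun.Build _ _ _ _ (add_marks r L) (measurable_add_marks r L).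

Definition forget_marks (z : T2 2) : T2 1 := ((forget1 (z.1 : cfg 2) : cfgm 1), z.2).

Lemma measurable_forget_marks : measurable_fun [set: T2 2] forget_marks.
Proof.
apply: measurable_fun_pair; last exact: measurable_snd.
apply: measurable_fun_cfgm => u v i b.
exact: (mpred_comp measurable_fst (mpred_entry u v (widen_ord (isT : 2 <= 3) i) b)).
Qed.

Lemma add_marksK r L z : forget_marks (add_marks r L z) = z.1.
Proof. by rewrite /forget_marks /= forget1_mark_with; case: z => [[]]. Qed.

Definition closed_adj (y : cfg 2) : rel nat :=
  fun a b => [&& Hadj y xi2 a b, ~~ vmark y om2 a & ~~ vmark y om2 b].

(* Measurable substitutes for (I) and (II). *)
Definition open_near_closed (h : nat) (y : cfg 2) : Prop :=
  forall v, Hv y xi2 v -> vmark y om2 v -> unbounded (Hadj y xi2) v ->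
    exists u (p : seq nat), [/\ Hv y xi2 u, ~~ vmark y om2 u, path (Hadj y xi2) v p,
      last v p = u & (size p <= h)%N].

Definition closed_clusters_large (N : nat) (y : cfg 2) : Prop :=
  forall v, Hv y xi2 v -> ~~ vmark y om2 v ->
    exists s : seq nat, [/\ uniq s, size s = N & forall a, a \in s -> reach (closed_adj y) v a].

Lemma mpred_vmark (k : nat) (i : 'I_k) u : mpred (fun y : cfgm k => vmark y i u).
Proof. exact: mpred_entry. Qed.

Lemma mpred_nvmark (k : nat) (i : 'I_k) u : mpred (fun y : cfgm k => ~~ vmark y i u).
Proof. by apply: mpred_ext (mpred_not (mpred_vmark i u)) => y; split=> /negP. Qed.

Lemma mpred_open_near_closed h : mpred (fun y : cfgm 2 => open_near_closed h y).
Proof.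
apply: mpred_all => v; apply: mpred_imply; first exact: mpred_Hv.
apply: mpred_imply; first exact: mpred_vmark.
apply: mpred_imply; first by apply: mpred_unbounded => a b; exact: mpred_Hadj.
apply: mpred_ex => u; apply: (mpred_ext (P := fun y : cfgm 2 => exists p : seq nat,
  Hv y xi2 u /\ (~~ vmark y om2 u /\ (path (Hadj y xi2) v p /\ (last v p = u /\ size p <= h))))).
  by move=> y; split=> [[p [? [? [? []]]]]|[p []]]; exists p.
apply: mpred_ex => p; apply: mpred_and; first exact: mpred_Hv.
apply: mpred_and; first exact: mpred_nvmark.
apply: mpred_and; last exact: mpred_cst.
by apply: mpred_path => a b; exact: mpred_Hadj.
Qed.

Lemma mpred_closed_clusters_large N : mpred (fun y : cfgm 2 => closed_clusters_large N y).
Proof.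
apply: mpred_all => v; apply: mpred_imply; first exact: mpred_Hv.
apply: mpred_imply; first exact: mpred_nvmark.
apply: (mpred_ext (P := fun y : cfgm 2 => exists s : seq nat, uniq s /\ (size s = N /\
    forall a, a \in s -> reach (closed_adj y) v a))).
  by move=> y; split=> [[s [? []]]|[s []]]; exists s.
apply: mpred_ex => s; apply: mpred_and; first exact: mpred_cst.
apply: mpred_and; first exact: mpred_cst.
apply: mpred_all => a; apply: mpred_imply; first exact: mpred_cst.
apply: mpred_reach => b c; apply: mpred_andb; first exact: mpred_Hadj.
by apply: mpred_andb; exact: mpred_nvmark.
Qed.

Lemma mpred_site_percolation : mpred (fun y : cfgm 2 => site_percolation y om2).
Proof.
apply: mpred_all => u; apply: mpred_all => v; apply: mpred_imply; first exact: mpred_adj.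
have me : mpred (fun y : cfgm 2 => emark y om2 u v) by apply: mpred_andb; exact: mpred_entry.
have mv : mpred (fun y : cfgm 2 => vmark y om2 u && vmark y om2 v).
  by apply: mpred_andb; exact: mpred_vmark.
apply: mpred_ext (mpred_and (mpred_imply me mv) (mpred_imply mv me)) => y.
by split=> [[ev ve]|->] //; apply/idP/idP.
Qed.

(* The set [Psi] of (II) is the whole closed cluster of [v]. *)
Lemma closed_cluster_connected (e : rel nat) (f : rel nat) v a b :
  (forall s t, e s t -> f s t) -> reach e v a -> reach e a b ->
  reach (fun s t => f s t && `[< component e v t >]) a b.
Proof.
move=> ef va [p [ep <-]]; exists p; split=> //.
elim: p a va ep => //= c p IH a va /andP[ac cp].
have vc : reach e v c by apply: reach_trans va _; exists [:: c]; rewrite /= ac.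
by rewrite ef //= IH // andbT; apply/asboolP.
Qed.

Lemma closed_cluster_witness N y v : closed_clusters_large N y ->
  Hv y xi2 v -> ~~ vmark y om2 v ->
  exists Psi : set nat,
    [/\ Psi v,
        (forall u, Psi u -> Hv y xi2 u /\ ~~ vmark y om2 u),
        (forall a b, Psi a -> Psi b ->
           reach (fun s t => Hadj y xi2 s t && `[< Psi t >]) a b) &
        exists s : seq nat, [/\ uniq s, size s = N & forall u, u \in s -> Psi u]].
Proof.
move=> large Hv_v nv; have [s [us sN sv]] := large v Hv_v nv.
have csym : symmetric (closed_adj y).
  by move=> a b; rewrite /closed_adj Hadj_sym [~~ vmark y om2 a && _]andbC.
exists (component (closed_adj y) v); split; first by exists [::].
- move=> u [p [ep <-]]; case/lastP: p ep => [//|p w].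
  rewrite rcons_path last_rcons => /andP[_ /and3P[/and4P[_ _ _ Hw] _ nw]].
  by split.
- move=> a b va vb; apply: closed_cluster_connected => //; first by move=> s' t /and3P[].
  exact: reach_trans (reach_sym csym va) vb.
- by exists s.
Qed.

(** * Law and unimodularity of the marked graph *)

Section Final.
Variables (R : realType) (mu : probability (T2 1) R) (r L : nat).
Local Open Scope ereal_scope.
Local Notation nu := (fair_coins R).

Definition marked_law : probability (T2 2) R := distribution (mu \x nu) (add_marks r L).

Lemma marked_law_forget (A : set (T2 1)) : measurable A ->
  marked_law (forget_marks @^-1` A) = mu A.
Proof.
move=> mA; transitivity ((mu \x nu) (A `*` setT)).
  congr ((mu \x nu) _); apply/seteqP.
  by split=> z; rewrite /= add_marksK // => -[].
transitivity (mu A * nu setT); first exact: product_measure1E.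
by rewrite probability_setT mule1.
Qed.

(** A null set upstairs is pushed forward only if its image event is measurable; hence the
    measurable substitutes for (I) and (II). *)
Lemma ae_marked_law (P : T2 2 -> Prop) : mpred P ->
  {ae mu \x nu, forall z, P (add_marks r L z)} -> {ae marked_law, forall z, P z}.
Proof.
move=> mP aeP; exists (~` [set z | P z]); split=> //; first exact: measurableC.
apply: (measure_negligible (mu := mu \x nu)) => //.
exact: (mpred_comp (P := fun z => ~ P z) (measurable_add_marks r L) (mpred_not mP)).
Qed.

Lemma ae_marked_law_forget (P : T2 1 -> Prop) :
  {ae mu, forall z, P z} -> {ae marked_law, forall z, P (forget_marks z)}.
Proof.
move=> [A [mA A0 PA]]; exists (forget_marks @^-1` A); split.
- by rewrite -[_ @^-1` _]setTI; exact: measurable_forget_marks.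
- by rewrite marked_law_forget.
- by move=> z nP; exact: PA.
Qed.

(** Composing a transport of marked graphs with the equivariant marking gives an equivariant
    transport depending on the coins, to which [mass_transport] applies. *)
Lemma unimodular_marked_law : unimodular mu -> unimodular marked_law.
Proof.
move=> um; split.
  apply: filterS (ae_marked_law_forget um.1) => z; exact: rooted_graph_forget1.
move=> f mf f0 fiso.
pose G x B a b := f ((mark_with x (open_marks r L x B) : cfgm 2), a, b).
have mG a b : measurable_fun [set: cfgm 1 * bits] (fun z => G z.1 z.2 a b).
  have m3 : measurable_fun [set: cfgm 1 * bits] (fun z =>
      ((mark_with z.1 (open_marks r L z.1 z.2) : cfgm 2), a, b) : T3 2).
    apply: measurable_fun_pair => //; apply: measurable_fun_pair => //.
    exact: measurable_mark_with.
  exact: (measurableT_comp mf m3).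
have Giso x y phi B B' a b : iso x y phi ->
    (forall u, vtx x u -> label B' (phi u) =1 label B u) -> vtx x a -> vtx x b ->
    G x B a b = G y B' (phi a) (phi b).
  move=> xy BB' xa xb; apply: fiso; last 2 first.
  - by rewrite -vtx_forget1 forget1_mark_with.
  - by rewrite -vtx_forget1 forget1_mark_with.
  apply: mark_with_iso => // u xu; rewrite /open_marks; congr (~~ _).
  by apply/asboolP/asboolP; rewrite -(closed_set_iso L r xy BB' xu).
have sumE (H : T2 2 -> nat -> T3 2) :
    (forall z o, H z o = (z.1, z.2, o)) \/ (forall z o, H z o = (z.1, o, z.2)) ->
  \int[marked_law]_z (\sum_(o <oo | vtx (z.1 : cfg 2) o) f (H z o)) =
  \int[mu \x nu]_z (\sum_(o <oo | vtx (z.1.1 : cfg 1) o) f (H (add_marks r L z) o)).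
  move=> HE; rewrite ge0_integral_pushforward //; first last.
  - by move=> z _; apply: nneseries_ge0 => *; exact: f0.
  - have mH o : measurable_fun [set: T2 2] (H ^~ o).
      case: HE => HE.
        have -> : H ^~ o = (fun z => (z.1, z.2, o)) by apply/funext => z; exact: HE.
        by apply: measurable_fun_pair => //; exact: measurable_fun_pair.
      have -> : H ^~ o = (fun z => (z.1, o, z.2)) by apply/funext => z; exact: HE.
      by apply: measurable_fun_pair => //; exact: measurable_fun_pair.
    have -> : (fun z : T2 2 => \sum_(o <oo | vtx (z.1 : cfg 2) o) f (H z o)) =
        (fun z => \sum_(o <oo) if vtx (z.1 : cfg 2) o then f (H z o) else 0).
      by apply/funext => z; exact: eseries_mkcond.
    apply: ge0_emeasurable_sum => [k z _ _|k _]; first by case: ifP.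
    apply: measurable_fun_ifP => //; last exact: (measurableT_comp mf (mH k)).
    exact: (mpred_comp (P := fun x : cfgm 2 => vtx x k) measurable_fst (mpred_entry _ _ _ _)).
  rewrite preimage_setT; apply: eq_integral => z _ /=.
  by rewrite -vtx_forget1 forget1_mark_with.
rewrite (sumE (fun z o => (z.1, z.2, o))); last by left.
rewrite (sumE (fun z o => (z.1, o, z.2))); last by right.
exact: (mass_transport mG (fun _ _ _ _ => f0 _) Giso um).
Qed.

End Final.

(** Bernoulli's inequality gives only linear growth, so it is squared: with n = 2m, (1 + a)^n is at
    least (m a)^2, and m > 10 / (eps a^2) beats 8m + 2, which is at most 10m. *)
Lemma exp_beats_linear (R : realType) (a eps : R) : (0 < a)%R -> (0 < eps)%R ->
  exists n, ((n.*2.*2.+2)%:R <= eps * (1 + a) ^+ n)%R.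
Proof.
move=> a0 e0; pose b := (10 / (eps * a ^+ 2))%R; pose m := (Num.truncn b).+1.
have mb : (10 <= eps * a ^+ 2 * m%:R)%R.
  rewrite mulrC -ler_pdivrMr ?mulr_gt0 ?exprn_gt0 //; exact/ltW/truncnS_gt.
have bernoulli k : (1 + k%:R * a <= (1 + a) ^+ k)%R.
  elim: k => [|k IH]; first by rewrite mul0r addr0 expr0.
  have ak : (0 <= k%:R * a)%R by rewrite mulr_ge0 // ltW.
  rewrite exprS -natr1; apply: le_trans (_ : _ <= (1 + a) * (1 + k%:R * a))%R _; first by nra.
  by apply: ler_wpM2l => //; lra.
have m1 : (1 <= m%:R :> R)%R by rewrite ler1n.
exists m.*2; rewrite -[in leRHS]muln2 exprM.
have am : (0 <= m%:R * a)%R by rewrite mulr_ge0 // ltW.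
have sq : ((m%:R * a) ^+ 2 <= ((1 + a) ^+ m) ^+ 2)%R.
  by have bm := bernoulli m; rewrite lerXn2r ?nnegrE //; lra.
apply: le_trans (_ : _ <= eps * (m%:R * a) ^+ 2)%R _; last by rewrite ler_wpM2l // ltW.
have -> : (m.*2.*2.*2.+2 = 8 * m + 2)%N by lia.
rewrite natrD natrM exprMn.
have : (10 * m%:R <= eps * a ^+ 2 * m%:R * m%:R)%R by rewrite ler_wpM2r.
have -> : (eps * (m%:R ^+ 2 * a ^+ 2) = eps * a ^+ 2 * m%:R * m%:R)%R by ring.
by move=> *; lra.
Qed.

Lemma open_near_closed_good (R : realType) (alpha : R) r L x B : good alpha x B ->
  r.*2.*2.+2 <= L -> open_near_closed r.+1 (mark_with x (open_marks r L x B)).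
Proof.
move=> gd rL v; rewrite -Hv_forget1 -Hadj_forget1 forget1_mark_with => _ _ ub.
have [u [p [Wu ep pu pr]]] := skeleton_dense (@Hadj_sym _ x xi1)
  (fun u => colouring_ex L u gd) r L ub.
exists u, p; split=> //; last exact: leqW.
- apply: (@unbounded_V (Hv x xi1) (Hadj x xi1)).
    by move=> a b /and4P[_ _ -> ->].
  exact: (skeleton_unbounded (@Hadj_sym _ x xi1) Wu).
- by rewrite vmark_mark_with negbK; apply/asboolP.
Qed.

Lemma closed_clusters_large_good (R : realType) (alpha : R) N r L x B : good alpha x B ->
  N.*2 + (r * 6).+1 <= L ->
  closed_clusters_large N (mark_with x (open_marks r L x B)).
Proof.
move=> gd NL v _; rewrite vmark_mark_with negbK => /asboolP Wv.
have [s [us sN sv]] := skeleton_large (@Hadj_sym _ x xi1)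
  (fun u => colouring_ex L u gd) (@colouring_inj L x B) (leqnn L) NL Wv.
exists s; split=> // a /sv[p [ep pa]]; exists p; split=> //.
apply: sub_path ep => b c; rewrite /closed_adj -Hadj_forget1 forget1_mark_with.
by rewrite !vmark_mark_with !negbK.
Qed.

Local Open Scope ring_scope.

Theorem theorem5p1 (R : realType) (alpha : R) (D : nat) (eps : R) :
  0 < alpha -> (2 <= D)%N -> 0 < eps -> eps < 1 / 2 ->
  exists h : nat, (0 < h)%N /\
  forall mu : probability (T2 1) R,
    unimodular mu ->
    {ae mu, forall z : T2 1, percolation (z.1 : cfg 1) xi1} ->
    {ae mu, forall z : T2 1,
       max_degree_le (Hv (z.1 : cfg 1) xi1) (Hadj (z.1 : cfg 1) xi1) D /\
       (forall u, Hv (z.1 : cfg 1) xi1 u ->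
          ~ finite_set (component (Hadj (z.1 : cfg 1) xi1) u) ->
          expansion_ge (Hadj (z.1 : cfg 1) xi1) (component (Hadj (z.1 : cfg 1) xi1) u) alpha)} ->
  forall N : nat, (0 < N)%N ->
  exists Q : probability (T2 2) R,
    [/\ (forall A : set (T2 1), measurable A ->
           Q ((fun z : T2 2 => ((forget1 (z.1 : cfg 2) : cfgm 1), z.2)) @^-1` A) = mu A),
        unimodular Q,
        {ae Q, forall z : T2 2, site_percolation (z.1 : cfg 2) om2},
        (Q [set z : T2 2 | ~~ vmark (z.1 : cfg 2) om2 z.2] <= eps%:E)%E &
        {ae Q, forall z : T2 2,
          let x := (z.1 : cfg 2) in
          (* (I) *)
          (forall v, Hv x xi2 v -> vmark x om2 v -> ~ finite_set (component (Hadj x xi2) v) ->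
             exists u (p : seq nat),
               [/\ Hv x xi2 u, ~~ vmark x om2 u, path (Hadj x xi2) v p,
                   last v p = u & (size p <= h)%N]) /\
          (* (II) *)
          (forall v, Hv x xi2 v -> ~~ vmark x om2 v ->
             exists Psi : set nat,
               [/\ Psi v,
                   (forall u, Psi u -> Hv x xi2 u /\ ~~ vmark x om2 u),
                   (forall a b, Psi a -> Psi b ->
                      reach (fun s t => Hadj x xi2 s t && `[< Psi t >]) a b) &
                   exists s : seq nat, [/\ uniq s, size s = N & forall u, u \in s -> Psi u]])}].
Proof.
move=> alpha0 _ eps0 _; have [n nP] := exp_beats_linear alpha0 eps0.
(* The scale [n] is fixed before [N]. The net S is [n.*2]-dense, and the extra one makes [h] visibly
   positive. [L] dominates both 4r + 2, for unique paths, and 2N + 6r + 1, for large clusters, where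
   r = 2n. *)
exists n.*2.+1; split=> // mu um _ expand N _; pose L := (N.*2 + (n.*2 * 6) + 4)%N.
have rL : (n.*2.*2.*2.+2 <= L)%N by rewrite /L; lia.
have NL : (N.*2 + (n.*2 * 6).+1 <= L)%N by rewrite /L; lia.
have F := ae_filter_ringOfSetsType (mu \x fair_coins R)%E.
have ae_good : {ae (mu \x fair_coins R)%E, forall z, good alpha (z.1.1 : cfg 1) z.2}.
  have := @filterI _ _ F _ _
    (@filterI _ _ F _ _ (ae_fst (fair_coins R) um.1) (ae_fst (fair_coins R) expand))
    (ae_snd mu (ae_distinct_labels R)).
  apply: (@filterS _ _ F) => z [[rooted [_ exp]] dist].
  have lf := Hadj_locally_finite xi1 rooted.
  split=> // u ub; apply: exp; last exact/unboundedP.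
  by apply: unbounded_V ub => a b /and4P[_ _ -> ->].
exists (marked_law mu n.*2 L); split.
- exact: marked_law_forget.
- exact: unimodular_marked_law.
- apply: ae_marked_law.
    exact: (mpred_comp measurable_fst mpred_site_percolation).
  by apply: (@filterE _ _ F) => z u v _ /=; rewrite emark_mark_with !vmark_mark_with.
- have rate := closed_set_rate um (ltW alpha0) rL ae_good.
  have a1 : 0 < (1 + alpha) ^+ n by rewrite exprn_gt0 // addr_gt0.
  have -> : marked_law mu n.*2 L [set z : T2 2 | ~~ vmark (z.1 : cfg 2) om2 z.2] =
      (mu \x fair_coins R)%E [set z | closed_set n.*2 L z.1.1 z.2 z.1.2].
    congr ((mu \x fair_coins R)%E _); apply/seteqP.
    by split=> z /=; rewrite vmark_mark_with negbK => /asboolP.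
  have a1E : (0 < ((1 + alpha) ^+ n)%:E)%E by rewrite lte_fin.
  rewrite -(@lee_pmul2l _ ((1 + alpha) ^+ n)%:E) //.
  by apply: le_trans rate _; rewrite -EFinM lee_fin mulrC.
- have aeI : {ae marked_law mu n.*2 L, forall z : T2 2, open_near_closed n.*2.+1 (z.1 : cfg 2)}.
    apply: ae_marked_law; first exact: (mpred_comp measurable_fst (mpred_open_near_closed _)).
    apply: (@filterS _ _ F) ae_good => z gd; exact: open_near_closed_good gd rL.
  have aeII : {ae marked_law mu n.*2 L, forall z : T2 2, closed_clusters_large N (z.1 : cfg 2)}.
    apply: ae_marked_law; first exact: (mpred_comp measurable_fst (mpred_closed_clusters_large _)).
    apply: (@filterS _ _ F) ae_good => z gd; exact: closed_clusters_large_good gd NL.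
  (* Rootedness supplies the finite degrees needed to pass from infinite components in (I) to
     [unbounded]. *)
  have rooted := ae_marked_law_forget n.*2 L um.1.
  have FQ := ae_filter_ringOfSetsType (marked_law mu n.*2 L).
  have aeQ := @filterI _ _ FQ _ _ (@filterI _ _ FQ _ _ aeI aeII) rooted.
  apply: (@filterS _ _ FQ) aeQ => z [[I II] /rooted_graph_forget1 rooted_z]; split.
    move=> v Hv_v open_v inf; apply: I => //; apply/unboundedP => //.
    exact: Hadj_locally_finite rooted_z.
  by move=> v Hv_v closed_v; exact: closed_cluster_witness II Hv_v closed_v.
Qed.
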